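(* Let $u$ be the smooth strictly convex solution of $\det D^2u=f$ in $\Omega$, $u=g$ on $\partial\Omega$, let $m',M'>0$ be constants with $m'\le\lambda_1(D^2u(x))\le\lambda_n(D^2u(x))\le M'$ for all $x\in\Omega$, and let $0<\delta<\min\{1,\ m'/(2nC_0)\}$. Then for $h$ sufficiently small and for all $v_h\in V^h$ with $\|v_h-Q_hu\|_1<\delta h^{1+n/2}/2$, the Hessian $D^2(v_h|_K)$ is positive definite on each element $K\in\mathcal T_h$, with $$\frac{m'}{2}\le\lambda_1\big(D^2(v_h|_K)\big)\le\lambda_n\big(D^2(v_h|_K)\big)\le\frac{3M'}{2}.$$ It follows that $v_h$ is convex.
   Context: Let $n\in\{2,3\}$ and let $\Omega\subset\mathbb R^n$ be a bounded convex domain with polygonal (polyhedral) boundary. $\mathcal T_h$ is a family of shape-regular, quasi-uniform triangulations of $\Omega$ into simplices with maximal diameter $h$, and $V^h=\{s\in C^1(\Omega): s|_K\in\mathcal P_d\ \forall K\in\mathcal T_h\}$, where $\mathcal P_d$ denotes the polynomials of degree at most $d$. $\|\cdot\|_{k,p}$, $|\cdot|_{k,p}$ are the norm and seminorm of $W^{k,p}(\Omega)$, and $\|\cdot\|_k,|\cdot|_k$ those of $H^k(\Omega)$; $|v|_{2,\infty}=\max_{i,j}\|\partial^2v/\partial x_i\partial x_j\|_{L^\infty(\Omega)}$. Standing assumptions on $V^h$. (Approximation) There are a linear quasi-interpolation operator $Q_h:L^1(\Omega)\to V^h$ and a constant $C$ independent of $h$ with $\|v-Q_hv\|_{k,p}\le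 Ch^{l+1-k}|v|_{l+1,p}$ for $v\in W^{l+1,p}(\Omega)$, $1\le p\le\infty$, $0\le k\le l\le d$. (Inverse estimates) $\|v\|_{s,p}\le Ch^{l-s+\min(0,n/p-n/q)}\|v\|_{l,q}$ for all $v\in V^h$, $0\le l\le s$, $1\le p,q\le\infty$, norms being understood element by element when necessary. In particular $C_0>0$ denotes a constant independent of $h$ such that $|v|_{2,\infty}\le C_0h^{-1-n/2}\|v\|_1$ for all $v\in V^h$. The function $f$ satisfies $f\ge c_0>0$, and $u\in W^{l+1,\infty}(\Omega)$ for some $l$ with $3\le l\le d$ is strictly convex. For a symmetric matrix $A$, $\lambda_1(A)$ and $\lambda_n(A)$ denote its smallest and largest eigenvalues. *)

(* Defs.v *)
From HB Require Import structures.
From mathcomp Require Import all_boot all_order all_algebra finmap.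
From mathcomp Require Import all_classical all_reals all_analysis.

Set Implicit Arguments.
Unset Strict Implicit.
Unset Printing Implicit Defensive.

Import Order.TTheory GRing.Theory Num.Theory numFieldNormedType.Exports.

Local Open Scope classical_set_scope.
Local Open Scope ring_scope.

Section measurable_rV.
Context (R : realType) (n : nat).

(* The product sigma-algebra on R^n, which is also the Borel one. *)
Let coor : 'I_n -> 'rV[R]_n -> R := fun i x => x 0 i.

Let rV_set0 : g_sigma_preimage coor set0.
Proof. exact: sigma_algebra0. Qed.

Let rV_setC A : g_sigma_preimage coor A -> g_sigma_preimage coor (~` A).
Proof. exact: sigma_algebraC. Qed.

Let rV_bigcup (F : (set _)^nat) : (forall i, g_sigma_preimage coor (F i)) ->
  g_sigma_preimage coor (\bigcup_i (F i)).
Proof. exact: sigma_algebra_bigcup. Qed.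

HB.instance Definition _ := @isMeasurable.Build default_measure_display
  'rV[R]_n (g_sigma_preimage coor) rV_set0 rV_setC rV_bigcup.

Lemma measurable_coor (i : 'I_n) :
  measurable_fun [set: 'rV[R]_n] (fun x : 'rV[R]_n => x 0 i).
Proof.
move=> _ Y mY; rewrite setTI; apply: sub_sigma_algebra => /=.
rewrite -bigcup_seq/=; exists i => /=; first by rewrite mem_index_enum.
by exists Y => //; rewrite setTI.
Qed.

Lemma measurable_fun_rVP d (S : measurableType d) (f : S -> 'rV[R]_n) :
  (forall i, measurable_fun [set: S] (fun s => f s 0 i)) ->
  measurable_fun [set: S] f.
Proof.
move=> mf _ A mA; rewrite setTI.
pose G := [set B : set 'rV[R]_n | measurable (f @^-1` B)].
suff : g_sigma_preimage coor `<=` G by apply.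
apply: smallest_sub.
  split.
  - by rewrite /G/= preimage_set0.
  - by move=> B GB; rewrite /G/= setTD -preimage_setC; exact: measurableC.
  - move=> F GF; rewrite /G/= preimage_bigcup.
    by apply: bigcupT_measurable => i; exact: GF.
move=> B; rewrite -bigcup_seq/= => -[i _ [C mC <-]].
by rewrite /G/= setTI; have := mf i measurableT _ mC; rewrite setTI.
Qed.

End measurable_rV.

Section lebesgue_step.
Context (R : realType) (n : nat).

Definition rV_cons (z : measurableTypeR R * 'rV[R]_n) : 'rV[R]_n.+1 :=
  row_mx (z.1%:M : 'rV[R]_1) z.2.

Definition rV_uncons (x : 'rV[R]_n.+1) : measurableTypeR R * 'rV[R]_n :=
  (x 0 ord0, \row_i x 0 (lift ord0 i)).

Lemma rV_cons0 z : rV_cons z 0 ord0 = z.1.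
Proof.
rewrite /rV_cons [X in _ 0 X](_ : ord0 = lshift n (ord0 : 'I_1)); last exact: val_inj.
by rewrite (@row_mxEl _ 1 1 n) mxE eqxx.
Qed.

Lemma rV_consS z (i : 'I_n) : rV_cons z 0 (lift ord0 i) = z.2 0 i.
Proof.
rewrite /rV_cons [X in _ 0 X](_ : lift ord0 i = rshift 1 i); last exact: val_inj.
by rewrite (@row_mxEr _ 1 1 n).
Qed.

Lemma rV_consK : cancel rV_cons rV_uncons.
Proof.
move=> [a y]; rewrite /rV_uncons rV_cons0; congr pair.
by apply/rowP => i; rewrite mxE rV_consS.
Qed.

Lemma rV_unconsK : cancel rV_uncons rV_cons.
Proof.
move=> x; apply/rowP => i; have [j|] := unliftP ord0 i => ->.
  by rewrite rV_consS mxE.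
by rewrite rV_cons0.
Qed.

Lemma measurable_rV_cons : measurable_fun setT rV_cons.
Proof.
apply: measurable_fun_rVP => i; have [j ->|->] := unliftP ord0 i.
  under eq_fun do rewrite rV_consS.
  by apply: (measurableT_comp (measurable_coor j)); exact: measurable_snd.
by under eq_fun do rewrite rV_cons0; exact: measurable_fst.
Qed.

Lemma measurable_rV_uncons : measurable_fun setT rV_uncons.
Proof.
apply/measurable_fun_pairP; split; first exact: measurable_coor.
apply: measurable_fun_rVP => i /=.
by under eq_fun do rewrite mxE; exact: measurable_coor.
Qed.

Variable mu : {sigma_finite_measure set 'rV[R]_n -> \bar R}.

Definition lebesgue_step : set 'rV[R]_n.+1 -> \bar R :=
  pushforward (lebesgue_measure \x mu)%E rV_cons.

Local Open Scope ereal_scope.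

Let step0 : lebesgue_step set0 = 0.
Proof. by rewrite /lebesgue_step /pushforward preimage_set0 measure0. Qed.

Let step_ge0 A : 0 <= lebesgue_step A.
Proof. by rewrite /lebesgue_step /pushforward; exact: measure_ge0. Qed.

Let step_sigma_additive : semi_sigma_additive lebesgue_step.
Proof.
move=> F mF tF mUF; rewrite /lebesgue_step /pushforward preimage_bigcup.
have mcons A : measurable A -> measurable (rV_cons @^-1` A).
  by move=> mA; rewrite -[X in measurable X]setTI; exact: measurable_rV_cons.
apply: measure_semi_sigma_additive.
- by move=> k; exact: mcons.
- apply/trivIsetP => /= i j _ _ ij; rewrite -preimage_setI.
  by move/trivIsetP : tF => /(_ _ _ _ _ ij) ->//; rewrite preimage_set0.
- by rewrite -preimage_bigcup; exact: mcons.
Qed.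

HB.instance Definition _ := isMeasure.Build _ _ _ lebesgue_step
  step0 step_ge0 step_sigma_additive.

Let step_sigma_finite : sigma_finite setT lebesgue_step.
Proof.
have /sigma_finiteP[F [TF ndF Foo]] := sigma_finiteT (@lebesgue_measure R).
have /sigma_finiteP[G [TG ndG Goo]] := sigma_finiteT mu.
exists (fun k => rV_uncons @^-1` (F k `*` G k)).
  apply/esym; rewrite -subTset => x _.
  have [i _ Fi] : (\bigcup_k F k) (rV_uncons x).1 by rewrite -TF.
  have [j _ Gj] : (\bigcup_k G k) (rV_uncons x).2 by rewrite -TG.
  exists (maxn i j) => //; split.
    by move: Fi; exact/subsetPset/ndF/leq_maxl.
  by move: Gj; exact/subsetPset/ndG/leq_maxr.
move=> k; have [mF Fk] := Foo k; have [mG Gk] := Goo k.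
have mFG := measurableX mF mG; split.
  by rewrite -[X in measurable X]setTI; exact: measurable_rV_uncons.
rewrite /lebesgue_step /pushforward -comp_preimage.
rewrite (_ : rV_uncons \o rV_cons = id); last first.
  by apply/funext => z /=; exact: rV_consK.
by rewrite preimage_id product_measure1E// lte_mul_pinfty// ge0_fin_numE.
Qed.

HB.instance Definition _ := Measure_isSigmaFinite.Build _ _ _ lebesgue_step
  step_sigma_finite.

End lebesgue_step.

Fixpoint lebesgue_rV (R : realType) (n : nat) :
    {sigma_finite_measure set 'rV[R]_n -> \bar R} :=
  match n with
  | 0%N => [the {sigma_finite_measure set 'rV[R]_0 -> \bar R} of
             dirac (0 : 'rV[R]_0)]
  | n'.+1 => [the {sigma_finite_measure set 'rV[R]_n'.+1 -> \bar R} of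
             lebesgue_step (lebesgue_rV R n')]
  end.
Arguments lebesgue_rV : clear implicits.

Lemma lebesgue_rV_box (R : realType) (n : nat) (a b : 'rV[R]_n) :
  (forall i, a 0 i <= b 0 i) ->
  lebesgue_rV R n [set x : 'rV[R]_n | forall i, a 0 i < x 0 i <= b 0 i] =
  (\prod_(i < n) (b 0 i - a 0 i))%:E.
Proof.
elim: n => [|n IHn] in a b *; move=> ab.
  rewrite big_ord0 /= diracE mem_set// => -[]//.
pose a' : 'rV[R]_n := \row_i a 0 (lift ord0 i).
pose b' : 'rV[R]_n := \row_i b 0 (lift ord0 i).
have mbox : measurable [set x : 'rV[R]_n | forall i, a' 0 i < x 0 i <= b' 0 i].
  rewrite (_ : [set x : 'rV[R]_n | _] =
    \bigcap_(i in [set: 'I_n]) [set x : 'rV[R]_n | a' 0 i < x 0 i <= b' 0 i]).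
    apply: fin_bigcap_measurable => // i _.
    rewrite (_ : [set x : 'rV[R]_n | _] =
        setT `&` (fun x : 'rV[R]_n => x 0 i) @^-1` `]a' 0 i, b' 0 i]%classic).
      by apply: measurable_coor => //; exact: measurable_itv.
    by apply/seteqP; split => x /=; rewrite in_itv/=; [move=> ->|case].
  by apply/seteqP; split => x /= h i; [move=> _; exact: h|exact: h].
rewrite /= /lebesgue_step /pushforward big_ord_recl EFinM.
rewrite (_ : _ @^-1` _ = `]a 0 ord0, b 0 ord0]%classic `*`
    [set x : 'rV[R]_n | forall i, a' 0 i < x 0 i <= b' 0 i]); last first.
  apply/seteqP; split => -[r y] /=.
    move=> h; split; first by rewrite in_itv/=; have := h ord0; rewrite rV_cons0.
    by move=> i; rewrite !mxE; have := h (lift ord0 i); rewrite rV_consS.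
  rewrite in_itv/= => -[r0 h] i; have [j ->|->] := unliftP ord0 i.
    by rewrite rV_consS; have := h j; rewrite !mxE.
  by rewrite rV_cons0.
rewrite product_measure1E//.
congr (_ * _)%E.
  rewrite [LHS](lebesgue_measure_itv `]a 0 ord0, b 0 ord0])/= lte_fin.
  case: ltP => // ba.
  by have -> : a 0 ord0 = b 0 ord0 by [apply/eqP; rewrite eq_le ab ba]; rewrite subrr.
rewrite IHn; last by move=> i; rewrite !mxE; exact: ab.
by congr (_%:E); apply: eq_bigr => i _; rewrite !mxE.
Qed.

Section calculus.
Context (R : realType) (n : nat).
Implicit Types (U : set 'rV[R]_n) (f : 'rV[R]_n -> R).

Definition partial (i : 'I_n) f : 'rV[R]_n -> R := fun x => 'D_('e_i) f x.

Fixpoint Ck (k : nat) U f : Prop :=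
  (forall x, U x -> {for x, continuous f}) /\
  (if k is k'.+1 then
     forall i, (forall x, U x -> derivable f x 'e_i) /\ Ck k' U (partial i f)
   else True).

Definition Dmulti (alpha : 'I_n -> nat) f : 'rV[R]_n -> R :=
  foldr (fun i => iter (alpha i) (partial i)) f (enum 'I_n).

Definition hessian f (x : 'rV[R]_n) : 'M[R]_n :=
  \matrix_(i, j) partial i (partial j f) x.

Definition poly_fun (d : nat) (p : 'rV[R]_n -> R) : Prop :=
  exists c : {ffun 'I_n -> 'I_d.+1} -> R, forall x,
    p x = \sum_(alpha : {ffun 'I_n -> 'I_d.+1} | (\sum_i alpha i <= d)%N)
            c alpha * \prod_i x 0 i ^+ alpha i.

Definition strictly_convex_on U f : Prop :=
  forall x y (t : R), U x -> U y -> x != y -> 0 < t < 1 ->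
    f (t *: x + (1 - t) *: y) < t * f x + (1 - t) * f y.

End calculus.

Section eigenvalues.
Context (R : realType) (n : nat).

(* Used on symmetric matrices only, whose set of (real) eigenvalues is finite
   and nonempty: inf and sup are then the smallest and largest eigenvalue. *)
Definition lambda_min (A : 'M[R]_n) : R := inf [set a | eigenvalue A a].
Definition lambda_max (A : 'M[R]_n) : R := sup [set a | eigenvalue A a].

Definition posdef (A : 'M[R]_n) : Prop :=
  A^T = A /\ forall x : 'rV[R]_n, x != 0 -> 0 < (x *m A *m x^T) 0 0.

End eigenvalues.

Section sobolev.
Context (R : realType) (n : nat).
Implicit Types (U : set 'rV[R]_n) (v g : 'rV[R]_n -> R) (p : \bar R).

Local Notation mu := (lebesgue_rV R n).

Definition locally_integrable_on U v : Prop :=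
  measurable_fun U v /\
  forall K, compact K -> K `<=` U -> (\int[mu]_(x in K) `|v x|%:E < +oo)%E.

Definition test_fun (k : nat) U (phi : 'rV[R]_n -> R) : Prop :=
  [/\ Ck k setT phi,
      compact (closure [set x | phi x != 0]) &
      closure [set x | phi x != 0] `<=` U].

(* g is the weak derivative D^alpha v on the open set U.  As in Gilbarg and
   Trudinger, the test functions are those of class C^|alpha| with compact
   support in U; by mollification this agrees with testing against smooth
   ones. *)
Definition weak_deriv U (alpha : 'I_n -> nat) v g : Prop :=
  let a := (\sum_i alpha i)%N in
  [/\ locally_integrable_on U v,
      locally_integrable_on U g &
      forall phi, test_fun a U phi ->
        \int[mu]_(x in U) (v x * Dmulti alpha phi x) =
        (-1) ^+ a * \int[mu]_(x in U) (g x * phi x)].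

Definition Lp_norm p U v : \bar R := 'N[mu]_p[EFin \o (v \_ U)].

Definition L1 U v : Prop := mu.-integrable U (EFin \o v).

Definition in_sobolev (k : nat) p U v : Prop :=
  forall alpha : {ffun 'I_n -> 'I_k.+1}, (\sum_i alpha i <= k)%N ->
    exists g, weak_deriv U (fun i => alpha i) v g /\ (Lp_norm p U g < +oo)%E.

(* A chosen representative of D^alpha v, unique up to a null set. *)
Definition wderiv U (alpha : 'I_n -> nat) v : 'rV[R]_n -> R :=
  xget (fun=> 0) [set g | weak_deriv U alpha v g].

Definition sobolev_sum (k : nat) (P : pred {ffun 'I_n -> 'I_k.+1}) p U v
    : \bar R :=
  let N (alpha : {ffun 'I_n -> 'I_k.+1}) :=
    Lp_norm p U (wderiv U (fun i => alpha i) v) in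
  if p is r%:E then ((\sum_(alpha | P alpha) N alpha `^ r) `^ r^-1)%E
  else \big[maxe/0%E]_(alpha | P alpha) N alpha.

(* These take the value +oo outside W^{k,p}(U). *)
Definition sobolev_norm (k : nat) p U v : \bar R :=
  if `[< in_sobolev k p U v >]
  then sobolev_sum (fun alpha : {ffun 'I_n -> 'I_k.+1} =>
         (\sum_i alpha i <= k)%N) p U v
  else +oo%E.

Definition sobolev_seminorm (k : nat) p U v : \bar R :=
  if `[< in_sobolev k p U v >]
  then sobolev_sum (fun alpha : {ffun 'I_n -> 'I_k.+1} =>
         (\sum_i alpha i == k)%N) p U v
  else +oo%E.

End sobolev.

Section triangulations.
Context (R : realType) (n : nat).
Implicit Types (Omega A : set 'rV[R]_n) (K : {fset 'rV[R]_n}).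

Definition polyhedral_convex_domain Omega : Prop :=
  [/\ Omega !=set0, open Omega, bounded_set Omega,
      convex_set (Omega : set (convex_lmodType 'rV[R]_n)) &
      exists s : seq ('rV[R]_n * R),
        Omega = [set x | forall ab, ab \in s ->
                           \sum_i ab.1 0 i * x 0 i < ab.2]].

(* The norm of the library on 'rV is the sup norm. *)
Definition enorm (x : 'rV[R]_n) : R := Num.sqrt (\sum_i x 0 i ^+ 2).

Definition diam A : R :=
  sup [set r | exists x y, [/\ A x, A y & r = enorm (x - y)]].

Definition inner_diam A : R :=
  sup [set r | exists (c : 'rV[R]_n) (s : R),
         [/\ 0 <= s, r = 2 * s & [set y | enorm (y - c) <= s] `<=` A]].

(* A simplex is given by its vertices. *)
Definition hull K : set 'rV[R]_n :=
  [set y | exists t : 'rV[R]_n -> R,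
     [/\ forall x, x \in K -> 0 <= t x,
         \sum_(x <- K) t x = 1 &
         y = \sum_(x <- K) t x *: x]].

Definition is_simplex K : Prop :=
  #|` K| = n.+1 /\
  forall t : 'rV[R]_n -> R,
    \sum_(x <- K) t x = 0 -> \sum_(x <- K) t x *: x = 0 ->
    forall x, x \in K -> t x = 0.

Definition triangulation Omega (Th : {fset {fset 'rV[R]_n}}) : Prop :=
  [/\ forall K, K \in Th -> is_simplex K,
      closure Omega = [set x | exists2 K, K \in Th & hull K x] &
      forall K K', K \in Th -> K' \in Th ->
        hull K `&` hull K' = hull (K `&` K')%fset].

(* Mesh sizes range over H; the mesh of size h is T h.  The last two clauses
   are shape regularity and quasi-uniformity. *)
Definition triangulation_family Omega (H : set R)
    (T : R -> {fset {fset 'rV[R]_n}}) : Prop :=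
  [/\ forall h, H h -> 0 < h /\ triangulation Omega (T h),
      forall h, H h -> (forall K, K \in T h -> diam (hull K) <= h) /\
                       (exists2 K, K \in T h & diam (hull K) = h),
      exists sigma : R, forall h K, H h -> K \in T h ->
        diam (hull K) <= sigma * inner_diam (hull K) &
      exists2 tau : R, 0 < tau & forall h K, H h -> K \in T h ->
        tau * h <= diam (hull K)].

(* The space V^h.  Functions are total; only their values on Omega matter. *)
Definition fe_space Omega (Th : {fset {fset 'rV[R]_n}}) (d : nat)
    (s : 'rV[R]_n -> R) : Prop :=
  Ck 1 Omega s /\
  forall K, K \in Th -> exists2 p, poly_fun d p &
    forall x, Omega x -> hull K x -> s x = p x.

(* Since the skeleton of the mesh is a null set, Sobolev norms on this open set
   are the norms taken element by element; they coincide with the norms on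
   Omega for the functions of W^{k,p}(Omega). *)
Definition element_interiors (Th : {fset {fset 'rV[R]_n}}) : set 'rV[R]_n :=
  [set x | exists2 K, K \in Th & interior (hull K) x].

Definition quasi_interpolation Omega (H : set R)
    (T : R -> {fset {fset 'rV[R]_n}}) (d : nat)
    (Q : R -> ('rV[R]_n -> R) -> ('rV[R]_n -> R)) : Prop :=
  forall h, H h ->
  [/\ forall v, L1 Omega v -> fe_space Omega (T h) d (Q h v),
      forall v w, L1 Omega v -> L1 Omega w ->
        {ae lebesgue_rV R n, forall x, Omega x -> v x = w x} ->
        forall x, Omega x -> Q h v x = Q h w x &
      forall (a : R) v w, L1 Omega v -> L1 Omega w ->
        forall x, Omega x ->
          Q h (fun y => a * v y + w y) x = a * Q h v x + Q h w x].

(* As usual for finite element estimates, C may depend on p, k and l but not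
   on h or v. *)
Definition approximation_property Omega (H : set R)
    (T : R -> {fset {fset 'rV[R]_n}}) (d : nat)
    (Q : R -> ('rV[R]_n -> R) -> ('rV[R]_n -> R)) : Prop :=
  forall (p : \bar R) (k l : nat), (1 <= p)%E -> (k <= l <= d)%N ->
  exists C : R, forall h v, H h -> in_sobolev l.+1 p Omega v ->
    (sobolev_norm k p (element_interiors (T h)) (v \- Q h v)%R
       <= (C * h ^+ (l + 1 - k))%:E * sobolev_seminorm l.+1 p Omega v)%E.

(* C may depend on p, q, l and s but not on h or v.  For extended exponents, fine (p^-1) is the real 1/p, with 1/oo = 0. *)
Definition inverse_estimates Omega (H : set R)
    (T : R -> {fset {fset 'rV[R]_n}}) (d : nat) : Prop :=
  forall (p q : \bar R) (l s : nat), (1 <= p)%E -> (1 <= q)%E -> (l <= s)%N ->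
  exists C : R, forall h v, H h -> fe_space Omega (T h) d v ->
    (sobolev_norm s p (element_interiors (T h)) v <=
       (C * h `^ (l%:R - s%:R + Num.min 0 (n%:R * fine (p^-1)%E
                                           - n%:R * fine (q^-1)%E)))%:E
       * sobolev_norm l q (element_interiors (T h)) v)%E.

End triangulations.

(* Main.v *)
(* The inverse estimate bounds the second derivatives of v_h - Q_h u on every
   element by C_0 delta / 2 < m' / (4 n), and the approximation property bounds
   those of u - Q_h u by m' / (4 n) for small h.  Hence the entries of
   D^2 (v_h|_K) and D^2 u differ by at most m' / (2 n), the quadratic forms by
   at most m' / 2, and the eigenvalue bounds follow from the Rayleigh quotient.
   The Sobolev norms only see weak derivatives; these agree with the classical
   ones on the interior of an element by integration by parts and the
   du Bois-Reymond lemma.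

   Convexity: restrict v_h to a segment and subtract the chord.  At a positive
   interior maximum, the pieces of v_h around the maximum lie strictly above
   their tangents, and since v_h is C^1 these tangents have the same slope on
   both sides, so the function increases on one side of its maximum. *)

Require Import Defs.
From HB Require Import structures.
From mathcomp Require Import all_boot all_order all_algebra finmap.
From mathcomp Require Import all_classical all_reals all_analysis.
From mathcomp Require Import measurable_realfun ess_sup_inf.
From mathcomp Require Import ring lra.

Set Implicit Arguments.
Unset Strict Implicit.
Unset Printing Implicit Defensive.

Import Order.TTheory GRing.Theory Num.Theory numFieldNormedType.Exports.

Local Open Scope classical_set_scope.
Local Open Scope ring_scope.

(** * Functions of class C^k and polynomials *)

(** The two estimates live on different open sets: the second derivatives of [v \- Q h u] are
    bounded on [Omega], those of [u \- Q h u] on the union of the element interiors. They are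
    compared on the part of the interior of [hull K] inside [Omega], where [u] is C^2, and where [v]
    and [Q h u] are polynomials; the polynomial of [Q h u] on [K] is the intermediate term. The
    conclusion concerns all of [hull K], including points of the boundary of [Omega], where nothing
    is known of the Hessian of [u]. It is reached by density, once the inequality mentions only the
    polynomial of [v].

    A segment may run inside a face or through low-dimensional intersections of elements, so it is
    never subdivided along the mesh. At the maximum it suffices that each nearby point of the
    segment shares an element with it, which follows from finiteness of the mesh and closedness of
    the elements.

    The upper bound arises as [M' + m' / 2], which is at most [3 * M' / 2] since [m' <= M']. *)

Section Ck_theory.
Context (R : realType) (n : nat).
Implicit Types (U : set 'rV[R]_n) (f g : 'rV[R]_n -> R) (x : 'rV[R]_n).

Lemma near_eq_continuous (S T : topologicalType) (f g : S -> T) (x : S) :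
  (\forall y \near x, f y = g y) -> {for x, continuous f} ->
  {for x, continuous g}.
Proof.
move=> fg cf; rewrite /prop_for /continuous_at -(nbhs_singleton fg).
exact/(cvg_trans (near_eq_cvg _))/cf.
Qed.

Lemma open_near_eq U f g x : open U -> (forall y, U y -> f y = g y) -> U x ->
  \forall y \near x, f y = g y.
Proof. by move=> oU fg Ux; apply: filterS (open_nbhs_nbhs (conj oU Ux)). Qed.

Lemma near_eq_partial f g x i :
  (\forall y \near x, f y = g y) -> partial i f x = partial i g x.
Proof. by move=> fg; rewrite /partial; apply: near_eq_derive. Qed.

(** Openness matters: a derivative at a point of [U] sees the values on a whole neighbourhood, and
    these must lie in [U]. *)
Lemma eq_Ck k U f g : open U -> (forall y, U y -> f y = g y) ->
  Ck k U f -> Ck k U g.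
Proof.
move=> oU; elim: k f g => [|k IHk] f g fg [cf df]; split => //.
- by move=> x Ux; apply: near_eq_continuous (cf x Ux); exact: open_near_eq fg Ux.
- by move=> x Ux; apply: near_eq_continuous (cf x Ux); exact: open_near_eq fg Ux.
- move=> i; have [{}df dfk] := df i; split.
    move=> x Ux; apply: near_eq_derivable _ (df x Ux).
    exact: open_near_eq fg Ux.
  by apply: IHk dfk => x Ux; apply: near_eq_partial; exact: open_near_eq fg Ux.
Qed.

Lemma Ck_continuous k U f x : Ck k U f -> U x -> {for x, continuous f}.
Proof. by case: k => [|k] [cf _]; exact: cf. Qed.

Lemma CkW k U f : Ck k.+1 U f -> Ck k U f.
Proof.
elim: k f => [|k IHk] f [cf df]; split => // i.
by have [{}df dfk] := df i; split => //; exact: IHk.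
Qed.

Lemma Ck_subset k U V f : V `<=` U -> Ck k U f -> Ck k V f.
Proof.
move=> VU; elim: k f => [|k IHk] f [cf df]; split => //.
- by move=> x /VU/cf.
- by move=> x /VU/cf.
- by move=> i; have [{}df /IHk] := df i; split => // x /VU/df.
Qed.

Lemma Ck_cst k U (c : R) : Ck k U (fun=> c).
Proof.
have cc (c' : R) x : U x -> {for x, continuous (fun=> c' : R)}.
  by move=> _; exact: cst_continuous.
elim: k c => [|k IHk] c; split => //; try exact: cc.
move=> i; split=> [x _|]; first exact: derivable_cst.
suff -> : partial i (fun=> c) = (fun=> 0 : R) :> ('rV[R]_n -> R) by exact: IHk.
by apply/funext => x; exact: derive_cst.
Qed.

Lemma Ck_add k U f g : open U ->
  Ck k U f -> Ck k U g -> Ck k U (fun x => f x + g x).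
Proof.
move=> oU; elim: k f g => [|k IHk] f g [cf df] [cg dg]; split => //.
- by move=> x Ux; apply: continuousD; [exact: cf|exact: cg].
- by move=> x Ux; apply: continuousD; [exact: cf|exact: cg].
- move=> i; have [{}df dfk] := df i; have [{}dg dgk] := dg i; split.
    by move=> x Ux; apply: derivableD; [exact: df|exact: dg].
  apply: eq_Ck (IHk _ _ dfk dgk) => // x Ux.
  by rewrite /partial deriveD//; [exact: df|exact: dg].
Qed.

Lemma Ck_mul k U f g : open U ->
  Ck k U f -> Ck k U g -> Ck k U (fun x => f x * g x).
Proof.
move=> oU; elim: k f g => [|k IHk] f g Cf Cg.
  by split => // x Ux; apply: continuousM; [exact: Ck_continuous Cf Ux
                                         |exact: Ck_continuous Cg Ux].
split.
  by move=> x Ux; apply: continuousM; [exact: Ck_continuous Cf Ux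
                                      |exact: Ck_continuous Cg Ux].
move=> i; have [_ /(_ i)[df dfk]] := Cf; have [_ /(_ i)[dg dgk]] := Cg.
split; first by move=> x Ux; apply: derivableM; [exact: df|exact: dg].
have := Ck_add oU (IHk _ _ dfk (CkW Cg)) (IHk _ _ (CkW Cf) dgk).
apply: eq_Ck => // x Ux; rewrite /partial deriveM//; [|exact: df|exact: dg].
by rewrite /GRing.scale/= addrC [g x * _]mulrC.
Qed.

Lemma Ck_sub k U f g : open U ->
  Ck k U f -> Ck k U g -> Ck k U (fun x => f x - g x).
Proof.
move=> oU Cf Cg; have := Ck_add oU Cf (Ck_mul oU (Ck_cst k U (-1)) Cg).
by apply: eq_Ck => // x _; rewrite mulN1r.
Qed.

Lemma Ck_exp k U f m : open U -> Ck k U f -> Ck k U (fun x => f x ^+ m).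
Proof.
move=> oU Cf; elim: m => [|m IHm]; first exact: eq_Ck (Ck_cst k U 1).
by have := Ck_mul oU Cf IHm; apply: eq_Ck => // x _; rewrite exprS.
Qed.

Lemma Ck_prod k U (I : Type) (s : seq I) (P : pred I) (F : I -> 'rV[R]_n -> R) :
  open U -> (forall i, P i -> Ck k U (F i)) ->
  Ck k U (fun x => \prod_(i <- s | P i) F i x).
Proof.
move=> oU CF; elim: s => [|i s IHs].
  by apply: eq_Ck (Ck_cst k U 1) => // x _; rewrite big_nil.
case Pi : (P i); last first.
  by apply: eq_Ck IHs => // x _; rewrite big_cons Pi.
by apply: eq_Ck (Ck_mul oU (CF _ Pi) IHs) => // x _; rewrite big_cons Pi.
Qed.

Lemma partialB U f g i x : open U -> Ck 1 U f -> Ck 1 U g -> U x ->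
  partial i (fun x => f x - g x) x = partial i f x - partial i g x.
Proof.
move=> oU [_ /(_ i)[df _]] [_ /(_ i)[dg _]] Ux.
by rewrite /partial deriveB//; [exact: df|exact: dg].
Qed.

Lemma partialB2 U f g i j x : open U -> Ck 2 U f -> Ck 2 U g -> U x ->
  partial i (partial j (fun x => f x - g x)) x =
  partial i (partial j f) x - partial i (partial j g) x.
Proof.
move=> oU Cf Cg Ux; have [_ /(_ j)[_ Cf1]] := Cf; have [_ /(_ j)[_ Cg1]] := Cg.
rewrite -(partialB i oU Cf1 Cg1 Ux); apply: near_eq_partial.
apply: open_near_eq Ux => // y Uy.
by rewrite (partialB _ oU (CkW Cf) (CkW Cg) Uy).
Qed.

Lemma is_derive_coord_comp (F : R -> R) (F' s a : R) (i : 'I_n) x v :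
  is_derive (s * x 0 i + a) (1 : R) F F' ->
  is_derive x v (fun y => F (s * y 0 i + a)) (s * v 0 i * F').
Proof.
move=> dF; pose l (y : 'rV[R]_n) := s * y 0 i + a.
have dl y : differentiable l y.
  apply: differentiableD; last exact: differentiable_cst.
  apply: differentiableM; first exact: differentiable_cst.
  exact: differentiable_coord.
have dFl : differentiable F (l x) by apply/derivable1_diffP; exact: ex_derive.
have dlv : 'D_v l x = s * v 0 i.
  rewrite /derive; apply: cvg_lim => //.
  apply: cvg_near_cst; near=> h; rewrite /l /= !mxE [_ *: _]/GRing.scale/=.
  have : h != 0 by near: h; exact: nbhs_dnbhs_neq.
  by move=> h0; field.
rewrite (_ : (fun y => _) = F \o l)//; apply: DeriveDef.
  by apply: diff_derivable; exact: differentiable_comp.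
rewrite deriveE; last exact: differentiable_comp.
rewrite (diff_comp (dl x) dFl) /=.
have -> : 'd l x v = s * v 0 i by rewrite -dlv deriveE.
have dF1 : derivable F (l x) 1 by exact: ex_derive.
by rewrite (deriv1E dF1) derive1E (@derive_val _ _ _ _ _ _ _ dF).
Unshelve. all: by end_near. Qed.

(** The family [G] is stable under differentiation up to a factor and a shift of the index, so the
    induction on [k] never leaves it. Truncated powers form such a family. *)
Lemma Ck_coord_comp k (G : nat -> R -> R) (s a : R) (i : 'I_n) (c : nat -> R) :
  (forall m, continuous (G m)) ->
  (forall m t, is_derive t (1 : R) (G m.+1) (c m * G m t)) ->
  Ck k setT (fun x : 'rV[R]_n => G k (s * x 0 i + a)).
Proof.
move=> cG dG.
have cl : continuous (fun x : 'rV[R]_n => s * x 0 i + a).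
  move=> x; apply: (@continuousD _ _ _ (fun x : 'rV[R]_n => s * x 0 i)); last exact: cst_continuous.
  by apply: continuousM; [exact: cst_continuous|exact: coord_continuous].
have cGl k' x : {for x, continuous (fun x : 'rV[R]_n => G k' (s * x 0 i + a))}.
  by apply: (continuous_comp (cl x)); exact: cG.
elim: k => [|k IHk]; split => //.
move=> j; have dx x := is_derive_coord_comp 'e_j (dG k (s * x 0 i + a)).
split; first by move=> x _; exact: (@ex_derive _ _ _ _ _ _ _ (dx x)).
have := Ck_mul openT (Ck_cst k setT (s * ('e_j : 'rV[R]_n) 0 i * c k)) IHk.
apply: eq_Ck; [exact: openT|move=> x _].
by rewrite /partial (@derive_val _ _ _ _ _ _ _ (dx x)) mulrA.
Qed.

End Ck_theory.

(** * Restriction to lines, symmetry of second derivatives, polynomials *)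

Section lines.
Context (R : realType) (n : nat).
Implicit Types (U : set 'rV[R]_n) (f g : 'rV[R]_n -> R) (x v : 'rV[R]_n).

Lemma is_derive_line f x v (s : R) : derivable f (s *: v + x) v ->
  is_derive s (1 : R) (fun s => f (s *: v + x)) ('D_v f (s *: v + x)).
Proof.
have E : (fun h : R => h^-1 *: (((fun r => f (r *: v + x)) \o shift s) (h *: (1 : R))
            - f (s *: v + x))) =
    (fun h => h^-1 *: ((f \o shift (s *: v + x)) (h *: v) - f (s *: v + x))).
  apply/funext => h /=; congr (_ *: (f _ - _)).
  by rewrite scalerDl addrA [_%:A]mulr1.
by move=> df; apply: DeriveDef; rewrite /derivable /derive E.
Qed.

Lemma is_derive_continuous (F : R -> R) s F' :
  is_derive s (1 : R) F F' -> {for s, continuous F}.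
Proof.
move=> [dF _]; apply: differentiable_continuous; exact/derivable1_diffP.
Qed.

Lemma MVT_is_derive (F F' : R -> R) (t : R) : 0 < t ->
  (forall s, 0 <= s <= t -> is_derive s (1 : R) F (F' s)) ->
  exists2 c, 0 < c < t & F t - F 0 = F' c * t.
Proof.
move=> t0 dF; have [||c] := @MVT _ F F' 0 t t0.
- by move=> s; rewrite in_itv/= => /andP[s0 st]; apply: dF; rewrite !ltW.
- apply: continuous_in_subspaceT => s; rewrite inE/= in_itv/= => /dF.
  exact: is_derive_continuous.
- by rewrite in_itv/= subr0 => c0t Fc; exists c.
Qed.

(* The second difference is symmetric in [i] and [j], whence [partialC]. *)
Lemma mixed_difference f U i j x (s : R) : Ck 2 U f -> 0 < s ->
  (forall a b : R, 0 <= a <= s -> 0 <= b <= s ->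
     U (a *: 'e_j + (b *: 'e_i + x))) ->
  exists2 ab : R * R, (0 <= ab.1 <= s) && (0 <= ab.2 <= s) &
    f (s *: 'e_j + (s *: 'e_i + x)) - f (s *: 'e_i + x)
      - f (s *: 'e_j + x) + f x =
    partial j (partial i f) (ab.1 *: 'e_j + (ab.2 *: 'e_i + x)) * s * s.
Proof.
move=> [cf df] s0 sU; have [dfi [cfi /(_ j)[dfij _]]] := df i.
have ss : 0 <= s <= s by rewrite lexx ltW.
have s00 : 0 <= (0 : R) <= s by rewrite lexx ltW.
have U0 b : 0 <= b <= s -> U (b *: 'e_i + x).
  by move=> bs; have := sU 0 b s00 bs; rewrite scale0r add0r.
(* [F] is the increment of [f] along ['e_j], as a function of the position along ['e_i]. One mean
   value point [b] thus serves both parallel lines, and [F' b] is again an increment along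
   ['e_j]. *)
pose F r := f (r *: 'e_i + (s *: 'e_j + x)) - f (r *: 'e_i + x).
pose F' r := partial i f (r *: 'e_i + (s *: 'e_j + x)) - partial i f (r *: 'e_i + x).
have [r r0s|b /andP[b0 bs] Fb] := @MVT_is_derive F F' s s0.
  apply: is_deriveB; apply: is_derive_line; apply: dfi; last exact: U0.
  by rewrite addrCA; exact: sU.
have bb : 0 <= b <= s by rewrite !ltW.
have [r r0s|a /andP[a0 as'] Ga] := @MVT_is_derive
    (fun r => partial i f (r *: 'e_j + (b *: 'e_i + x)))
    (fun r => partial j (partial i f) (r *: 'e_j + (b *: 'e_i + x))) s s0.
  by apply: is_derive_line; apply: dfij; exact: sU.
exists (a, b); first by rewrite /= bb !ltW.
move: Fb; rewrite /= -Ga /F /F' !scale0r !add0r => Fb.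
rewrite [s *: _ + (b *: _ + _)]addrCA -Fb [s *: 'e_j + (s *: 'e_i + _)]addrCA.
by ring.
Qed.

Lemma norm_e_le1 (k : 'I_n) : `|'e_k : 'rV[R]_n| <= 1.
Proof.
rewrite [leLHS]/Num.Def.normr/= mx_normrE; apply/bigmax_leP; split => // -[p q] _ /=.
by rewrite mxE; case: (_ && _); rewrite ?normr1 ?normr0.
Qed.
Lemma norm_shift2_le x (s : R) k l (a b : R) : 0 <= a <= s -> 0 <= b <= s ->
  `|x - (a *: 'e_k + (b *: 'e_l + x))| <= s + s.
Proof.
move=> /andP[a0 as'] /andP[b0 bs].
have -> : x - (a *: 'e_k + (b *: 'e_l + x)) = - (a *: 'e_k + b *: 'e_l).
  by rewrite [in LHS]addrA opprD addrCA subrr addr0.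
rewrite normrN; apply: le_trans (ler_normD _ _) _.
rewrite !normrZ (ger0_norm a0) (ger0_norm b0).
apply: lerD; by rewrite -[leRHS]mulr1 ler_pM// norm_e_le1.
Qed.

Lemma partialC f U i j x : open U -> Ck 2 U f -> U x ->
  partial i (partial j f) x = partial j (partial i f) x.
Proof.
move=> oU Cf Ux; have [_ df] := Cf.
have [_ [_ /(_ j)[_ [cA _]]]] := df i.
have [_ [_ /(_ i)[_ [cB _]]]] := df j.
apply/eqP; rewrite -subr_eq0 -normr_le0; apply/ler_addgt0Pr => e e0; rewrite add0r.
have e2 : 0 < e / 2 by rewrite divr_gt0.
have /nbhs_normP[d /= d0 dU] : \forall y \near x, [/\ U y,
    `|partial j (partial i f) x - partial j (partial i f) y| < e / 2 &
    `|partial i (partial j f) x - partial i (partial j f) y| < e / 2].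
  have /cvgrPdist_lt/(_ _ e2) nA := cA x Ux.
  have /cvgrPdist_lt/(_ _ e2) nB := cB x Ux.
  have nU : nbhs x U by exact: open_nbhs_nbhs.
  by move: nU nA nB; apply: filterS3 => y; exact: And3.
(* All points of the square are within [s + s] of [x] for the sup norm, and this has to stay below
   [d]. *)
pose s := d / 4; have s0 : 0 < s by rewrite divr_gt0.
have ball_s k l a b : 0 <= a <= s -> 0 <= b <= s ->
    `|x - (a *: 'e_k + (b *: 'e_l + x))| < d.
  move=> as' bs; apply: le_lt_trans (norm_shift2_le _ _ _ as' bs) _.
  by rewrite /s; move: d0; clear; lra.
have [[a b]/= /andP[as' bs] E1] := mixed_difference (i := i) (j := j) Cf s0
  (fun a b ha hb => let: And3 h _ _ := dU _ (ball_s _ _ _ _ ha hb) in h).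
have [[a' b']/= /andP[as2 bs2] E2] := mixed_difference (i := j) (j := i) Cf s0
  (fun a b ha hb => let: And3 h _ _ := dU _ (ball_s _ _ _ _ ha hb) in h).
have [_ A1 _] := dU _ (ball_s j i _ _ as' bs).
have [_ _ B1] := dU _ (ball_s i j _ _ as2 bs2).
move: E1 E2 A1 B1.
set PA := partial j (partial i f) (_ + _); set PB := partial i (partial j f) (_ + _).
move: PA PB => PA PB E1 E2 A1 B1.
have s1 : s != 0 by rewrite gt_eqF.
(* Both products equal the same second difference. Hence [PA = PB], a common value within [e / 2] of
   each mixed derivative at [x]. *)
have EE : PA * s * s = PB * s * s.
  by rewrite -E1 -E2 [s *: 'e_j + _]addrCA; congr (_ + _); exact: addrAC.
have E := mulIf s1 (mulIf s1 EE); rewrite E distrC in A1.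
move: A1 B1; set X := partial i (partial j f) x.
set Y := partial j (partial i f) x; move: X Y => X Y A1 B1.
rewrite -(subrKA PB); apply: le_trans (ler_normD _ _) _.
by rewrite (splitr e); apply: lerD; exact: ltW.
Qed.

Lemma hessian_sym f U x : open U -> Ck 2 U f -> U x ->
  (hessian f x)^T = hessian f x.
Proof.
by move=> oU Cf Ux; apply/matrixP => i j; rewrite !mxE; exact: partialC oU Cf Ux.
Qed.

(** The degree is forgotten: keeping only the closure rules makes differentiability and stability
    under [partial] structural inductions. *)
Inductive polynomial : ('rV[R]_n -> R) -> Prop :=
| polynomial_cst c : polynomial (fun=> c)
| polynomial_coord i : polynomial (fun x => x 0 i)
| polynomial_add f g :
    polynomial f -> polynomial g -> polynomial (fun x => f x + g x)
| polynomial_mul f g :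
    polynomial f -> polynomial g -> polynomial (fun x => f x * g x).

Lemma polynomial_differentiable f x : polynomial f -> differentiable f x.
Proof.
elim=> [c|i|{}f g _ df _ dg|{}f g _ df _ dg].
- exact: differentiable_cst.
- exact: differentiable_coord.
- exact: differentiableD.
- exact: differentiableM.
Qed.

Lemma polynomial_derivable f x v : polynomial f -> derivable f x v.
Proof. by move=> pf; apply: diff_derivable; exact: polynomial_differentiable. Qed.

Lemma polynomial_partial i f : polynomial f -> polynomial (partial i f).
Proof.
elim=> [c|j|{}f g pf IHf pg IHg|{}f g pf IHf pg IHg].
- rewrite (_ : partial _ _ = fun=> 0); first exact: polynomial_cst.
  by apply/funext => x; exact: derive_cst.
- rewrite (_ : partial _ _ = fun=> ('e_i : 'rV[R]_n) 0 j); first exact: polynomial_cst.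
  apply/funext => x; have := @is_derive_coord_comp R n id 1 1 0 j x 'e_i _.
  rewrite (_ : (fun y : 'rV[R]_n => id _) = (fun y : 'rV[R]_n => y 0 j)); last first.
    by apply/funext => y; rewrite mul1r addr0.
  by move=> /(_ (is_derive_id _ _))[_]; rewrite mul1r mulr1.
- rewrite (_ : partial _ _ = fun x => partial i f x + partial i g x).
    exact: polynomial_add.
  by apply/funext => x; rewrite /partial deriveD//; exact: polynomial_derivable.
- rewrite (_ : partial _ _ = fun x => f x * partial i g x + g x * partial i f x).
    by apply: polynomial_add; exact: polynomial_mul.
  by apply/funext => x; rewrite /partial deriveM//; exact: polynomial_derivable.
Qed.

Lemma polynomial_Ck k U f : polynomial f -> Ck k U f.
Proof.
elim: k f => [|k IHk] f pf; (split => //;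
    first by move=> x _; exact/differentiable_continuous/polynomial_differentiable).
move=> i; split; first by move=> x _; exact: polynomial_derivable.
exact/IHk/polynomial_partial.
Qed.

Lemma polynomial_sum (I : Type) (s : seq I) (P : pred I) (F : I -> 'rV[R]_n -> R) :
  (forall i, P i -> polynomial (F i)) ->
  polynomial (fun x => \sum_(i <- s | P i) F i x).
Proof.
move=> pF; elim: s => [|i s IHs].
  by under eq_fun do rewrite big_nil; exact: polynomial_cst.
under eq_fun do rewrite big_cons.
by case Pi : (P i) => //; apply: polynomial_add => //; exact: pF.
Qed.

Lemma polynomial_prod (I : Type) (s : seq I) (P : pred I) (F : I -> 'rV[R]_n -> R) :
  (forall i, P i -> polynomial (F i)) ->
  polynomial (fun x => \prod_(i <- s | P i) F i x).
Proof.
move=> pF; elim: s => [|i s IHs].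
  by under eq_fun do rewrite big_nil; exact: polynomial_cst.
under eq_fun do rewrite big_cons.
by case Pi : (P i) => //; apply: polynomial_mul => //; exact: pF.
Qed.

Lemma poly_fun_polynomial d f : poly_fun d f -> polynomial f.
Proof.
move=> [c cE]; have -> := funext cE.
apply: polynomial_sum => a _; apply: polynomial_mul; first exact: polynomial_cst.
apply: polynomial_prod => i _; elim: (nat_of_ord (a i)) => [|m IHm].
  by under eq_fun do rewrite expr0; exact: polynomial_cst.
under eq_fun do rewrite exprS.
by apply: polynomial_mul => //; exact: polynomial_coord.
Qed.

Lemma derive_partial f x v : differentiable f x ->
  'D_v f x = \sum_i v 0 i * partial i f x.
Proof.
move=> df; rewrite deriveE// [in LHS](row_sum_delta v) linear_sum/=.
by apply: eq_bigr => i _; rewrite linearZ/= /partial deriveE.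
Qed.

Lemma polynomial_is_derive_line f x v (s : R) : polynomial f ->
  is_derive s (1 : R) (fun s => f (s *: v + x))
    (\sum_i v 0 i * partial i f (s *: v + x)).
Proof.
move=> pf; rewrite -derive_partial; last exact: polynomial_differentiable.
by apply: is_derive_line; exact: polynomial_derivable.
Qed.

(* Two applications of the mean value theorem along the segment. *)
Lemma posdef_above_tangent f x v : polynomial f -> v != 0 ->
  (forall s : R, 0 <= s <= 1 -> posdef (hessian f (s *: v + x))) ->
  f x + \sum_i v 0 i * partial i f x < f (v + x).
Proof.
move=> pf v0 pd.
pose G s := \sum_i v 0 i * partial i f (s *: v + x).
have [s _|c /andP[c0 c1]] := @MVT_is_derive (fun s => f (s *: v + x)) G 1 ltr01.
  exact: polynomial_is_derive_line.
rewrite scale1r scale0r add0r mulr1 => Ec.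
have [s _|b /andP[b0 bc]] := @MVT_is_derive G
   (fun s => \sum_i v 0 i * \sum_j v 0 j * partial j (partial i f) (s *: v + x)) c c0.
  rewrite /G (_ : (fun s => _) = \sum_i (fun s => v 0 i * partial i f (s *: v + x))); last first.
    by apply/funext => r; rewrite fct_sumE.
  apply: is_derive_sum => i; apply: is_deriveZ.
  by apply: polynomial_is_derive_line; exact: polynomial_partial.
move=> Eb.
have : G 0 < G c.
  rewrite -subr_gt0 Eb mulr_gt0//.
  have [|_ /(_ v v0)] := pd b.
    by rewrite (ltW b0) (ltW (lt_trans bc c1)).
  congr (_ < _); rewrite mxE.
  apply: eq_bigr => i _; rewrite mxE mulr_suml mxE mulr_sumr.
  by apply: eq_bigr => j _; rewrite mxE; ring.
by rewrite -ltrBrDl Ec {1}/G; under eq_bigr do rewrite scale0r add0r.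
Qed.

End lines.

(** * Boxes and Borel sets of R^n *)

Section boxes.
Context (R : realType) (n : nat).
Implicit Types (U : set 'rV[R]_n) (a c x : 'rV[R]_n).
Local Notation mu := (lebesgue_rV R n).

Definition obox a c : set 'rV[R]_n := [set x | forall i, a 0 i < x 0 i < c 0 i].
Definition cbox a c : set 'rV[R]_n := [set x | forall i, a 0 i <= x 0 i <= c 0 i].

Lemma obox_cbox a c : obox a c `<=` cbox a c.
Proof. by move=> x ax i; have /andP[/ltW -> /ltW ->] := ax i. Qed.

Lemma rV_sub_coor (P : 'I_n -> set R) :
  [set x : 'rV[R]_n | forall i, P i (x 0 i)] =
  \bigcap_(i in [set: 'I_n]) (fun x : 'rV[R]_n => x 0 i) @^-1` P i.
Proof. by apply/seteqP; split => x /= h i; [move=> _|]; exact: h. Qed.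

Lemma measurable_coor_preimage (P : 'I_n -> set R) :
  (forall i, measurable (P i)) ->
  measurable [set x : 'rV[R]_n | forall i, P i (x 0 i)].
Proof.
move=> mP; rewrite rV_sub_coor; apply: fin_bigcap_measurable => // i _.
by rewrite -[X in measurable X]setTI; exact: measurable_coor.
Qed.

Lemma measurable_obox a c : measurable (obox a c).
Proof.
rewrite (_ : obox a c = [set x : 'rV[R]_n | forall i, `]a 0 i, c 0 i[%classic (x 0 i)]).
  by apply: (@measurable_coor_preimage (fun i => `]a 0 i, c 0 i[%classic)) => i; exact: measurable_itv.
by apply/seteqP; split => x /= h i; have := h i; rewrite /= in_itv.
Qed.

Lemma measurable_cbox a c : measurable (cbox a c).
Proof.
rewrite (_ : cbox a c = [set x : 'rV[R]_n | forall i, `[a 0 i, c 0 i]%classic (x 0 i)]).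
  by apply: (@measurable_coor_preimage (fun i => `[a 0 i, c 0 i]%classic)) => i; exact: measurable_itv.
by apply/seteqP; split => x /= h i; have := h i; rewrite /= in_itv.
Qed.

Lemma closed_cbox a c : closed (cbox a c).
Proof.
rewrite (_ : cbox a c = [set x : 'rV[R]_n | forall i, `[a 0 i, c 0 i]%classic (x 0 i)]); last first.
  by apply/seteqP; split => x /= h i; have := h i; rewrite /= in_itv.
rewrite (@rV_sub_coor (fun i => `[a 0 i, c 0 i]%classic)); apply: closed_bigI => i _.
by apply: closed_comp => [x _|]; [exact: coord_continuous|exact: itv_closed].
Qed.

Lemma compact_cbox a c : compact (cbox a c).
Proof.
rewrite (_ : cbox a c = [set x : 'rV[R]_n | forall i, `[a 0 i, c 0 i]%classic (x ord0 i)]).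
  by apply: (@rV_compact _ _ (fun i => `[a 0 i, c 0 i]%classic)) => i; exact: segment_compact.
by apply/seteqP; split => x /= h i; have := h i; rewrite /= in_itv.
Qed.

Lemma cbox_finite a c : (mu (cbox a c) < +oo)%E.
Proof.
(* The known volume is that of half-open boxes with ordered corners: [Num.min] orders the corners if
   the box is empty, and subtracting 1 absorbs the closed lower faces. *)
pose a' : 'rV[R]_n := \row_i (Num.min (a 0 i) (c 0 i) - 1).
have h i : a' 0 i <= c 0 i.
  by rewrite mxE lerBlDr; apply: (@le_trans _ _ (c 0 i)); rewrite ?ge_min ?lexx ?orbT// lerDl.
apply: (@le_lt_trans _ _ (mu [set x : 'rV[R]_n | forall i, a' 0 i < x 0 i <= c 0 i])); last first.
  by rewrite lebesgue_rV_box// ltry.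
apply: le_measure; rewrite ?inE; [exact: measurable_cbox| |].
  rewrite (_ : [set x | _] = [set x : 'rV[R]_n | forall i, `]a' 0 i, c 0 i]%classic (x 0 i)]).
    by apply: (@measurable_coor_preimage (fun i => `]a' 0 i, c 0 i]%classic)) => i; exact: measurable_itv.
  by apply/seteqP; split => x /= h' i; have := h' i; rewrite /= in_itv.
move=> x xac i; have /andP[ax ->] := xac i; rewrite andbT mxE.
apply: lt_le_trans ax; rewrite ltrBlDr; apply: (@le_lt_trans _ _ (a 0 i)).
  by rewrite ge_min lexx.
by rewrite ltrDl.
Qed.

Lemma obox_mu_gt0 a c : (forall i, a 0 i < c 0 i) -> (0 < mu (obox a c))%E.
Proof.
(* Stopping at the midpoints leaves a half-open box, of known volume, inside the open one. *)
move=> ac; pose c' : 'rV[R]_n := \row_i ((a 0 i + c 0 i) / 2).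
have h i : a 0 i < c' 0 i < c 0 i by rewrite mxE; have := ac i; lra.
apply: (@lt_le_trans _ _ (mu [set x : 'rV[R]_n | forall i, a 0 i < x 0 i <= c' 0 i])).
  rewrite lebesgue_rV_box => [|i]; last by have /andP[/ltW] := h i.
  by rewrite lte_fin prodr_gt0// => i _; rewrite subr_gt0; have /andP[] := h i.
apply: le_measure; rewrite ?inE; [|exact: measurable_obox|].
  rewrite (_ : [set x | _] = [set x : 'rV[R]_n | forall i, `]a 0 i, c' 0 i]%classic (x 0 i)]).
    by apply: (@measurable_coor_preimage (fun i => `]a 0 i, c' 0 i]%classic)) => i; exact: measurable_itv.
  by apply/seteqP; split => x /= h' i; have := h' i; rewrite /= in_itv.
move=> x xac i; have /andP[-> xc] := xac i.
by apply: le_lt_trans xc _; have /andP[] := h i.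
Qed.

Definition rat_row (q : 'rV[rat]_n) : 'rV[R]_n := \row_i ratr (q 0 i).

(** Balls of the sup norm are boxes: rational corners within [d / 2] of [x] in each coordinate keep
    the closed box in the ball of radius [d]. Rationality makes the family of boxes countable. *)
Lemma open_rat_box U x : open U -> U x ->
  exists q : 'rV[rat]_n * 'rV[rat]_n,
    obox (rat_row q.1) (rat_row q.2) x /\ cbox (rat_row q.1) (rat_row q.2) `<=` U.
Proof.
move=> oU Ux; have /nbhs_normP[d /= d0 dU] : nbhs x U by exact: open_nbhs_nbhs.
have /choice[p pP] i : exists p : rat, x 0 i - d / 2 < ratr p < x 0 i.
  have [|p] := @rat_in_itvoo R (x 0 i - d / 2) (x 0 i).
    by rewrite ltrBlDr ltrDl divr_gt0.
  by rewrite in_itv/=; exists p.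
have /choice[q qP] i : exists q : rat, x 0 i < ratr q < x 0 i + d / 2.
  have [|q] := @rat_in_itvoo R (x 0 i) (x 0 i + d / 2).
    by rewrite ltrDl divr_gt0.
  by rewrite in_itv/=; exists q.
exists (\row_i p i, \row_i q i); split => [i|y yb].
  by rewrite !mxE; have /andP[_ ->] := pP i; have /andP[-> _] := qP i.
apply: dU => /=; rewrite [ltLHS]/Num.Def.normr/= mx_normrE; apply/bigmax_ltP; split => //.
move=> [k i] _ /=; rewrite [k]ord1 !mxE.
have := yb i; rewrite !mxE => /andP[py yq].
have /andP[p1 p2] := pP i; have /andP[q1 q2] := qP i.
by rewrite ltr_distlC; apply/andP; split; lra.
Qed.

Lemma open_rat_bigcup U : open U ->
  U = \bigcup_q (if `[< cbox (rat_row q.1) (rat_row q.2) `<=` U >]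
                 then obox (rat_row q.1) (rat_row q.2) else set0).
Proof.
move=> oU; apply/seteqP; split => [x Ux|x [q _]].
  have [q [xq qU]] := open_rat_box oU Ux.
  by exists q => //; case: asboolP.
by case: asboolP => // qU /obox_cbox/qU.
Qed.

Lemma open_measurable_rV U : open U -> measurable U.
Proof.
move=> oU; rewrite (open_rat_bigcup oU); apply: countable_bigcupT_measurable.
  exact: countableP.
by move=> q; case: ifP => _; [exact: measurable_obox|exact: measurable0].
Qed.

Lemma closed_measurable_rV U : closed U -> measurable U.
Proof. by rewrite -openC => /open_measurable_rV/measurableC; rewrite setCK. Qed.

Lemma continuous_on_measurable U (f : 'rV[R]_n -> R) : open U ->
  (forall x, U x -> {for x, continuous f}) -> measurable_fun U f.
Proof.
move=> oU cf; apply: (measurability _ (RGenOInfty.measurableE R)).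
move=> /= _ [_ [r ->]] <-; apply: open_measurable_rV.
rewrite openE => x [Ux fx]; apply: filterI; first exact: open_nbhs_nbhs.
by apply: cf => //; apply: open_nbhs_nbhs; split => //; exact: itv_open.
Qed.

Lemma continuous_measurable_rV (f : 'rV[R]_n -> R) :
  continuous f -> measurable_fun setT f.
Proof.
by move=> cf; apply: continuous_on_measurable => [|x _]; [exact: openT|exact: cf].
Qed.

Definition oboxes : set (set 'rV[R]_n) := [set A | exists a c, A = obox a c].

Lemma oboxI a c a' c' : obox a c `&` obox a' c' =
  obox (\row_i Num.max (a 0 i) (a' 0 i)) (\row_i Num.min (c 0 i) (c' 0 i)).
Proof.
apply/seteqP; split => [x [/= h h'] i|x h].
  rewrite !mxE gt_max lt_min.
  by have /andP[-> ->] := h i; have /andP[-> ->] := h' i.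
by split => i; have := h i; rewrite !mxE gt_max lt_min
  => /andP[/andP[? ?] /andP[? ?]]; exact/andP.
Qed.

Lemma setI_oboxes : setI_closed oboxes.
Proof.
by move=> _ _ [a [c ->]] [a' [c' ->]]; rewrite oboxI; eexists; eexists.
Qed.

(** The sigma-algebra is defined through the coordinates, whereas a Dynkin argument needs a
    pi-system of generators. Open sets link the two: they are countable unions of boxes, and
    coordinates pull open rays back to open sets. *)
Lemma measurable_rV_oboxes : @measurable _ 'rV[R]_n = <<s oboxes >>.
Proof.
have oG U : open U -> <<s oboxes >> U.
  move=> oU; rewrite (open_rat_bigcup oU).
  have : @measurable _ (g_sigma_algebraType oboxes) (\bigcup_q
      (if `[< cbox (rat_row q.1) (rat_row q.2) `<=` U >]
       then obox (rat_row q.1) (rat_row q.2) else set0)).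
    apply: countable_bigcupT_measurable; first exact: countableP.
    move=> q; case: ifP => _; last exact: measurable0.
    by apply: sub_sigma_algebra; exists (rat_row q.1), (rat_row q.2).
  by [].
apply/seteqP; split; last first.
  apply: smallest_sub; first exact: sigma_algebra_measurable.
  by move=> _ [a [c ->]]; exact: measurable_obox.
apply: smallest_sub; first exact: smallest_sigma_algebra.
move=> B; rewrite -bigcup_seq/= => -[i _ [C mC <-]].
have : measurable_fun [set: g_sigma_algebraType oboxes]
    ((fun x => x 0 i) : g_sigma_algebraType oboxes -> R).
  apply: (measurability _ (RGenOInfty.measurableE R)).
  move=> /= _ [_ [r ->]] <-; rewrite setTI.
  apply: oG; apply: open_comp; last exact: itv_open_ends_open.
  by move=> x _; exact: coord_continuous.
by move=> /(_ measurableT _ mC).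
Qed.

End boxes.

(** * Test functions and the du Bois-Reymond lemma *)

Section bump.
Context (R : realType) (n : nat).
Implicit Types (U : set 'rV[R]_n) (a c x : 'rV[R]_n).
Local Notation mu := (lebesgue_rV R n).

(* The exponent is [k.+1] because [pos_pow k] must be of class C^k at 0. *)
Definition pos_pow k (t : R) : R := Num.max 0 t ^+ k.+1.

Lemma pos_pow_continuous k : continuous (pos_pow k).
Proof.
move=> t.
apply: (@continuous_comp _ _ _ (fun s : R => Num.max 0 s) (fun s : R => s ^+ k.+1)).
  by apply: (@continuous_max _ _ (fun=> 0) id); [exact: cst_continuous|exact: cvg_id].
exact: exprn_continuous.
Qed.

Lemma pos_pow_is_derive k t :
  is_derive t (1 : R) (pos_pow k.+1) (k.+2%:R * pos_pow k t).
Proof.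
have [t0|t0|->] := ltgtP t 0.
- rewrite /pos_pow (max_idPl (ltW t0)) expr0n mulr0.
  have d0 : is_derive t (1 : R) (fun=> 0 : R) 0 by exact: is_derive_cst.
  apply: near_eq_is_derive d0; near=> s.
  have s0 : s <= 0 by near: s; exact: lt_le_nbhsl.
  by rewrite (max_idPl s0) expr0n.
- have -> : k.+2%:R * pos_pow k t = k.+2%:R *: t ^+ k.+1 *: (1 : R).
    by rewrite /pos_pow (max_idPr (ltW t0)) [RHS]mulr1.
  have dX : is_derive t (1 : R) (fun s : R => s ^+ k.+2) (k.+2%:R *: t ^+ k.+1 *: (1 : R)).
    by apply: DeriveDef; [exact: exprn_derivable|exact: exp_derive].
  apply: near_eq_is_derive dX; near=> s.
  have s0 : 0 <= s by near: s; exact: lt_le_nbhsr.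
  by rewrite /pos_pow (max_idPr s0).
- have -> : k.+2%:R * pos_pow k 0 = 0 by rewrite /pos_pow maxxx expr0n mulr0.
  (* At 0 the difference quotient is at most [|h| ^+ k.+1] in absolute value, hence at most [|h|]
     once [|h| <= 1]. *)
  have c0 : (fun h : R => h^-1 *: ((pos_pow k.+1 \o shift 0) (h *: (1 : R)) - pos_pow k.+1 0))
      @ 0^' --> (0 : R).
    apply/cvgrPdist_le => e e0; near=> h.
    have h0 : h != 0 by near: h; exact: nbhs_dnbhs_neq.
    have he : `|h| <= e by near: h; apply: dnbhs0_le.
    have h1 : `|h| <= 1 by near: h; apply: dnbhs0_le.
    rewrite /= [h%:A]mulr1 addr0 {2}/pos_pow maxxx expr0n subr0 sub0r normrN normrM normfV.
    rewrite ler_pdivrMl ?normr_gt0// /pos_pow normrX.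
    have hm : `|Num.max 0 h| <= `|h|.
      by case: (leP 0 h) => _; rewrite ?normr0.
    apply: (@le_trans _ _ (`|h| ^+ k.+2)); first by rewrite lerXn2r// nnegrE.
    rewrite exprS ler_wpM2l// exprS; apply: le_trans he.
    by rewrite -[leRHS]mulr1 ler_wpM2l// exprn_ile1.
  by apply: DeriveDef; [apply/cvg_ex; exists 0|exact: cvg_lim].
Unshelve. all: by end_near. Qed.

(** The arguments are written as [s * x 0 i + b] to suit [Ck_coord_comp]; [bump_factorE] gives the
    readable form. Division by the length of the side keeps the values in [0, 1]. *)
Definition bump_factor k a c (i : 'I_n) x : R :=
  pos_pow k ((c 0 i - a 0 i)^-1 * x 0 i - (c 0 i - a 0 i)^-1 * a 0 i) *
  pos_pow k (- (c 0 i - a 0 i)^-1 * x 0 i + (c 0 i - a 0 i)^-1 * c 0 i).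

Definition bump k a c x : R := \prod_i bump_factor k a c i x.

Lemma bump_factorE k a c i x : bump_factor k a c i x =
  pos_pow k ((x 0 i - a 0 i) / (c 0 i - a 0 i)) *
  pos_pow k ((c 0 i - x 0 i) / (c 0 i - a 0 i)).
Proof. by rewrite /bump_factor; congr (pos_pow _ _ * pos_pow _ _); ring. Qed.

Lemma bump_factor01 k a c i x : a 0 i < c 0 i -> 0 <= bump_factor k a c i x <= 1.
Proof.
move=> ac; have d0 : 0 < c 0 i - a 0 i by rewrite subr_gt0.
have p0 t : 0 <= pos_pow k t by rewrite exprn_ge0// le_max lexx.
have pn t : t <= 0 -> pos_pow k t = 0.
  by move=> t0; rewrite /pos_pow (max_idPl t0) expr0n.
have p1 t : t <= 1 -> pos_pow k t <= 1.
  by move=> t1; rewrite exprn_ile1// ?le_max ?lexx// ge_max ler01 t1.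
rewrite bump_factorE mulr_ge0//=.
have [xa|ax] := leP (x 0 i) (a 0 i).
  by rewrite pn ?mul0r// pmulr_lle0 ?invr_gt0// subr_le0.
have [cx|xc] := leP (c 0 i) (x 0 i).
  by rewrite [X in _ * X]pn ?mulr0// pmulr_lle0 ?invr_gt0// subr_le0.
by apply: mulr_ile1 => //; apply: p1; rewrite ler_pdivrMr// mul1r; lra.
Qed.

Lemma bump_factor_eq0 k a c i x : a 0 i < c 0 i ->
  (bump_factor k a c i x == 0) = ~~ (a 0 i < x 0 i < c 0 i).
Proof.
move=> ac; have d0 : 0 < c 0 i - a 0 i by rewrite subr_gt0.
have pn t : (pos_pow k t == 0) = (t <= 0).
  rewrite /pos_pow expf_eq0/=; case: (leP t 0) => [|t0]; first by rewrite eqxx.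
  by rewrite gt_eqF.
by rewrite bump_factorE mulf_eq0 !pn !pmulr_lle0 ?invr_gt0// !subr_le0 negb_and !ltNge !negbK.
Qed.

Lemma bump01 k a c x : (forall i, a 0 i < c 0 i) -> 0 <= bump k a c x <= 1.
Proof.
move=> ac; apply/andP; split.
  by apply: prodr_ge0 => i _; have /andP[] := bump_factor01 k x (ac i).
by apply: prodr_ile1 => i _; exact: bump_factor01.
Qed.

Lemma bump_neq0 k a c x : (forall i, a 0 i < c 0 i) ->
  (bump k a c x != 0) <-> obox a c x.
Proof.
move=> ac; split.
  move=> /prodf_neq0 b0 i; have := b0 i isT.
  by rewrite bump_factor_eq0// negbK.
by move=> xac; apply/prodf_neq0 => i _; rewrite bump_factor_eq0// negbK; exact: xac.
Qed.

Lemma bump_Ck k a c : Ck k setT (bump k a c).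
Proof.
have Cp i (s b : R) : Ck k setT (fun x : 'rV[R]_n => pos_pow k (s * x 0 i + b)).
  apply: (@Ck_coord_comp R n k pos_pow s b i (fun m => m.+2%:R)).
    exact: pos_pow_continuous.
  exact: pos_pow_is_derive.
apply: Ck_prod => [|i _]; first exact: openT.
by apply: Ck_mul => //; exact: openT.
Qed.

(* A polynomial in the C^k function [bump], hence C^k, that tends to the
   indicator of the open box as [j] grows. *)
Definition plateau k a c j x : R := 1 - (1 - bump k a c x) ^+ j.

Lemma plateau_Ck k a c j : Ck k setT (plateau k a c j).
Proof.
have o := openT : open [set: 'rV[R]_n].
apply: Ck_sub => //; first exact: Ck_cst.
by apply: Ck_exp => //; apply: Ck_sub => //; [exact: Ck_cst|exact: bump_Ck].
Qed.

Lemma plateau01 k a c j x : (forall i, a 0 i < c 0 i) -> 0 <= plateau k a c j x <= 1.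
Proof.
move=> ac; have /andP[b0 b1] := bump01 k x ac.
rewrite subr_ge0 exprn_ile1 ?subr_ge0 ?gerBl//=.
by rewrite exprn_ge0 ?subr_ge0.
Qed.

Lemma plateau_out k a c j x : (forall i, a 0 i < c 0 i) ->
  ~ obox a c x -> plateau k a c j x = 0.
Proof.
move=> ac xac; rewrite /plateau (_ : bump k a c x = 0); last first.
  by apply/eqP; rewrite -[_ == _]negbK; apply/negP => /(bump_neq0 k x ac).
by rewrite subr0 expr1n subrr.
Qed.

Lemma plateau_cvg k a c x : (forall i, a 0 i < c 0 i) -> obox a c x ->
  plateau k a c j x @[j --> \oo] --> (1 : R).
Proof.
move=> ac xac; rewrite -[X in _ --> X]subr0; apply: cvgB; first exact: cvg_cst.
apply: cvg_expr; have /andP[b0 b1] := bump01 k x ac.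
rewrite ger0_norm ?subr_ge0// gtrBl lt_neqAle b0 andbT eq_sym.
exact/bump_neq0.
Qed.

Lemma test_fun_cbox k U a c (phi : 'rV[R]_n -> R) : Ck k setT phi ->
  (forall x, phi x != 0 -> cbox a c x) -> cbox a c `<=` U -> test_fun k U phi.
Proof.
move=> Cphi phi0 acU.
have clac : closure [set x | phi x != 0] `<=` cbox a c.
  by rewrite closureE; apply: smallest_sub => //; exact: closed_cbox.
split => //; last exact: subset_trans acU.
by apply: subclosed_compact clac; [exact: closed_closure|exact: compact_cbox].
Qed.

Lemma plateau_test_fun k U a c j : (forall i, a 0 i < c 0 i) ->
  cbox a c `<=` U -> test_fun k U (plateau k a c j).
Proof.
move=> ac; apply: test_fun_cbox; first exact: plateau_Ck.
move=> x /eqP; apply: contra_notP => xac; apply: plateau_out => // /obox_cbox.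
by [].
Qed.

Lemma locally_integrable_compact U K (v : 'rV[R]_n -> R) : measurable U ->
  locally_integrable_on U v -> compact K -> K `<=` U ->
  mu.-integrable K (EFin \o v).
Proof.
move=> mU [mv iv] cK KU.
have mK : measurable K.
  by apply: closed_measurable_rV; apply: compact_closed => //; exact: norm_hausdorff.
apply/integrableP; split; last exact: iv.
by apply/measurable_EFinP; exact: measurable_funS mv.
Qed.

(* Dominated convergence along the plateaus shows that [v] has integral 0 over
   every box, and boxes form a pi-system generating the sigma-algebra. *)
Lemma du_Bois_Reymond_box k U a c (v : 'rV[R]_n -> R) : open U ->
  locally_integrable_on U v ->
  (forall phi, test_fun k U phi -> \int[mu]_(x in U) (v x * phi x) = 0) ->
  cbox a c `<=` U -> {ae mu, forall x, obox a c x -> v x = 0}.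
Proof.
move=> oU lv vphi acU.
have mU := open_measurable_rV oU.
have vi : mu.-integrable (cbox a c) (EFin \o v).
  exact: locally_integrable_compact mU lv (@compact_cbox _ _ _ _) acU.
have vio : mu.-integrable (obox a c) (EFin \o v).
  apply: integrableS vi; [exact: measurable_cbox|exact: measurable_obox|].
  exact: obox_cbox.
have vbox a' c' : cbox a' c' `<=` cbox a c ->
    (\int[mu]_(x in obox a' c') (v x)%:E = 0)%E.
  move=> acs.
  have [ac'|/existsNP[i /negP]] := pselect (forall i, a' 0 i < c' 0 i); last first.
    rewrite -leNgt => ci; rewrite (_ : obox a' c' = set0) ?integral_set0//.
    rewrite -subset0 => x /(_ i)/andP[/lt_trans h /h].
    by rewrite ltNge ci.
  have vi' : mu.-integrable (obox a' c') (EFin \o v).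
    apply: integrableS vi; [exact: measurable_cbox|exact: measurable_obox|].
    by move=> x /obox_cbox/acs.
  have mbo := measurable_obox a' c'.
  have mv := measurable_int _ vi'.
  have mp j : measurable_fun (obox a' c') (plateau k a' c' j).
    apply: measurable_funTS; apply: continuous_measurable_rV => x.
    by apply: Ck_continuous (plateau_Ck _ _ _ _) _.
  have mvp j : measurable_fun (obox a' c') (fun x => (v x * plateau k a' c' j x)%:E).
    by apply/measurable_EFinP; apply: measurable_funM => //; exact/measurable_EFinP.
  have vp_le j x : (`|(v x * plateau k a' c' j x)%:E| <= `|(v x)%:E|)%E.
    rewrite lee_fin normrM ler_piMr//.
    by have /andP[p0 p1] := plateau01 k j x ac'; rewrite ger0_norm.
  have vpi j : mu.-integrable (obox a' c') (fun x => (v x * plateau k a' c' j x)%:E).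
    by apply: le_integrable vi' => //.
  have vp0 j : (\int[mu]_(x in obox a' c') (v x * plateau k a' c' j x)%:E = 0)%E.
    have := vphi _ (@plateau_test_fun k U a' c' j ac' (subset_trans acs acU)).
    rewrite /Rintegral.
    have -> : (\int[mu]_(x in U) (v x * plateau k a' c' j x)%:E =
        \int[mu]_(x in obox a' c') (v x * plateau k a' c' j x)%:E)%E.
      rewrite integral_mkcond [RHS]integral_mkcond; apply: eq_integral => x _.
      rewrite !patchE; case: ifPn => xU; case: ifPn => // xb.
        by rewrite plateau_out ?mulr0//; move: xb; rewrite notin_setE.
      by exfalso; move/negP: xU; apply; rewrite inE; move: xb; rewrite inE => /obox_cbox/acs/acU.
    by move=> h; rewrite -[LHS]fineK ?h//; exact: integrable_fin_num.
  have [||_ _] := @dominated_convergence _ _ _ mu (obox a' c') mbo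
    (fun j x => (v x * plateau k a' c' j x)%:E) (EFin \o v) (abse \o (EFin \o v))
    mvp mv _ (integrable_abse vi') _.
  - apply: aeW => x xb; apply: cvg_EFin; first exact: nearW.
    rewrite -[X in _ --> X]mulr1; apply: cvgM; first exact: cvg_cst.
    exact: plateau_cvg.
  - by apply: aeW => x j _; exact: vp_le.
  - under eq_fun do rewrite vp0.
    by move=> cv; rewrite -(cvg_lim _ cv)// lim_cst.
have : ae_eq mu (obox a c) (EFin \o v) (cst 0%E).
  apply: integral_ae_eq => //; first exact: measurable_obox.
  move=> E Eac mE; rewrite integral_cst// mul0e.
  suff : (\int[mu]_(x in obox a c `&` E) (v x)%:E = 0)%E by rewrite setIidr.
  have mb := measurable_obox a c.
  have iS A : measurable A -> mu.-integrable (obox a c `&` A) (EFin \o v).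
    by move=> mA; apply: integrableS vio => //; exact: measurableI.
  (* Sets with this property are stable under complement because the integral over the whole box is
     0, and under disjoint countable unions because [v] is integrable on the box. *)
  apply: (@dynkin_induction _ _ (@oboxes R n)
     (fun E => (\int[mu]_(x in obox a c `&` E) (v x)%:E = 0)%E)).
  - exact: measurable_rV_oboxes.
  - exact: setI_oboxes.
  - by rewrite setIT vbox//; exact: subset_refl.
  - move=> _ [a' [c' ->]]; rewrite oboxI; apply: vbox => x xb i.
    have := xb i; rewrite !mxE ge_max le_min => /andP[/andP[-> _] /andP[-> _]].
    by [].
  - move=> S mS S0.
    have : (\int[mu]_(x in (obox a c `&` S) `|` (obox a c `&` ~` S)) (v x)%:E = 0)%E.
      by rewrite -setIUr setUv setIT vbox//; exact: subset_refl.
    rewrite integral_setU_EFin ?S0 ?add0e//.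
    + exact: measurableI.
    + by apply: measurableI => //; exact: measurableC.
    + rewrite -setIUr setUv setIT; apply/measurable_EFinP.
      exact: measurable_int vio.
    + by apply/disj_setPS => x [[_ Sx] [_ nSx]].
  - move=> F mF tF F0; rewrite setI_bigcupr integral_bigcup.
    + by rewrite eseries0.
    + exact: trivIset_setIl.
    + by move=> i; exact: measurableI.
    + by rewrite -setI_bigcupr; apply: iS; exact: bigcupT_measurable.
  - by rewrite -measurable_rV_oboxes.
by apply: filterS => x h xac; have [] := h xac.
Qed.

(** The rational boxes inside [U] cover it and are countable, so their exceptional null sets add up
    to a null set. The boxes are enumerated by their codes in [nat]; a number that codes no box
    carries the statement [True]. *)
Lemma du_Bois_Reymond k U (v : 'rV[R]_n -> R) : open U ->
  locally_integrable_on U v ->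
  (forall phi, test_fun k U phi -> \int[mu]_(x in U) (v x * phi x) = 0) ->
  {ae mu, forall x, U x -> v x = 0}.
Proof.
move=> oU lv vphi.
have : {ae mu, forall x m, (if (choice.unpickle m : option ('rV[rat]_n * 'rV[rat]_n)) is Some q then
    cbox (rat_row R q.1) (rat_row R q.2) `<=` U ->
    obox (rat_row R q.1) (rat_row R q.2) x -> v x = 0 else True)}.
  apply: ae_foralln => m; case: (choice.unpickle m) => [q|]; last exact: aeW.
  have [qU|qU] := pselect (cbox (rat_row R q.1) (rat_row R q.2) `<=` U).
    by apply: filterS (du_Bois_Reymond_box oU lv vphi qU) => x h _.
  exact: aeW.
apply: filterS => x h Ux; have [q [xq qU]] := open_rat_box oU Ux.
by have := h (choice.pickle q); rewrite choice.pickleK; exact.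
Qed.

End bump.

(** * Integration by parts *)

Section divergence.
Context (R : realType).

Definition cube n (M : R) : set 'rV[R]_n := cbox (const_mx (- M)) (const_mx M).

Lemma cubeE n (M : R) (x : 'rV[R]_n) : cube M x <-> forall i, `|x 0 i| <= M.
Proof.
by split=> h i; have := h i; rewrite !mxE ler_norml.
Qed.

Lemma coor_norm_le n (x : 'rV[R]_n) i : `|x 0 i| <= `|x|.
Proof.
rewrite [leRHS]/Num.Def.normr/= mx_normrE.
by apply/bigmax_geP; right; exists (ord0, i).
Qed.

Lemma compact_sub_cube n (K : set 'rV[R]_n) : compact K ->
  exists M : R, K `<=` cube M.
Proof.
move=> /compact_bounded[M [_ hM]]; exists (M + 1) => x Kx; apply/cubeE => i.
by apply: le_trans (coor_norm_le x i) _; apply: hM Kx; rewrite ltrDl.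
Qed.

Lemma compact_image_bounded (S : topologicalType) (K : set S) (w : S -> R) :
  compact K -> {within K, continuous w} -> [bounded w x | x in K].
Proof.
move=> cK cw; have /compact_bounded[N [Nr hN]] := continuous_compact cw cK.
by exists N; split => // y Ny x xK; apply: hN Ny _ _; exists x.
Qed.

Lemma compact_measure_lty n (K : set 'rV[R]_n) : measurable K -> compact K ->
  (lebesgue_rV R n K < +oo)%E.
Proof.
move=> mK /compact_sub_cube[M KM]; apply: le_lt_trans (cbox_finite _ _).
by apply: le_measure KM; rewrite ?inE//; exact: measurable_cbox.
Qed.

Lemma continuous_supp_integrable n (F : 'rV[R]_n -> R) (M : R) : continuous F ->
  (forall x, ~ cube M x -> F x = 0) ->
  (lebesgue_rV R n).-integrable setT (EFin \o F).
Proof.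
move=> cF F0.
have mc : measurable (cube M : set 'rV[R]_n) by exact: measurable_cbox.
have -> : EFin \o F = (EFin \o F) \_ (cube M).
  apply/funext => x; rewrite patchE; case: ifPn => //; rewrite notin_setE => xM.
  by rewrite /= F0.
apply/(integrable_mkcond (EFin \o F) mc); apply: measurable_bounded_integrable => //.
- exact: cbox_finite.
- by apply: measurable_funTS; exact: continuous_measurable_rV.
- apply: compact_image_bounded; first exact: compact_cbox.
  exact: continuous_subspaceT.
Qed.

Lemma rV_cons_line n (r : R) (y : 'rV[R]_n) :
  rV_cons (r, y) = r *: 'e_ord0 + rV_cons (0, y).
Proof.
apply/rowP => i; have [j ->|->] := unliftP ord0 i.
  by rewrite rV_consS mxE rV_consS !mxE andbC/= mulr0 add0r.
by rewrite rV_cons0 mxE rV_cons0 !mxE mulr1 addr0.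
Qed.

Lemma rV_cons_add n (h : R) (r : R) (v y : 'rV[R]_n) :
  rV_cons (r, h *: v + y) = h *: rV_cons (0, v) + rV_cons (r, y).
Proof.
apply/rowP => i; rewrite [RHS]mxE [X in _ = X + _]mxE.
have [j ->|->] := unliftP ord0 i; first by rewrite !rV_consS !mxE.
by rewrite !rV_cons0 mulr0 add0r.
Qed.

Lemma rV_cons_e n (j : 'I_n) : rV_cons (0, 'e_j) = 'e_(lift ord0 j) :> 'rV[R]_n.+1.
Proof.
apply/rowP => i; have [k ->|->] := unliftP ord0 i.
  by rewrite rV_consS !mxE (inj_eq lift_inj).
by rewrite rV_cons0 !mxE.
Qed.

(** Prefixing a fixed coordinate preserves distances for the sup norm. *)
Lemma rV_cons_continuousr n (r : R) : continuous (fun y : 'rV[R]_n => rV_cons (r, y)).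
Proof.
move=> y; apply: (iffRL (@cvgrPdist_lt R 'rV[R]_n.+1 _ (nbhs y) (nbhs_filter y) _ _)) => e e0.
have /cvgrPdist_lt/(_ _ e0) : (fun z : 'rV[R]_n => z) x @[x --> y] --> y by exact: cvg_id.
apply: filterS => z yz.
have -> : rV_cons (r, y) - rV_cons (r, z) = rV_cons (0, y - z).
  apply/rowP => i; rewrite [LHS]mxE [X in _ + X = _]mxE.
  have [k ->|->] := unliftP ord0 i; first by rewrite !rV_consS !mxE.
  by rewrite !rV_cons0 subrr.
move: yz; rewrite [ltLHS]/Num.Def.normr/= mx_normrE => /bigmax_ltP[_ yz].
rewrite [ltLHS]/Num.Def.normr/= mx_normrE; apply/bigmax_ltP; split => // -[k i] _ /=.
rewrite [k]ord1; have [j ->|->] := unliftP ord0 i.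
  by rewrite rV_consS; exact: (yz (ord0, j)).
by rewrite rV_cons0 normr0.
Qed.

Lemma integral_derive1_supp (psi f : R -> R) (M : R) : continuous f ->
  (forall r, is_derive r (1 : R) psi (f r)) ->
  (forall r, M < `|r| -> psi r = 0 /\ f r = 0) ->
  (\int[lebesgue_measure]_r (f r)%:E = 0)%E.
Proof.
(* This [N] is positive and exceeds [M] whatever the sign of [M]: [psi] vanishes at both ends of
   [[- N, N]], and [f] outside. *)
move=> cf df f0; pose N := `|M| + 1.
have N0 : 0 < N by rewrite ltr_wpDl.
have MN r : N <= `|r| -> M < `|r|.
  by apply: lt_le_trans; rewrite (le_lt_trans (ler_norm M))// ltrDl.
have cpsi r : {for r, continuous psi} by exact: is_derive_continuous.
rewrite (_ : (fun r => (f r)%:E) = (fun r => (f r)%:E) \_ `[- N, N]).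
  rewrite -integral_mkcond (@continuous_FTC2 _ _ psi).
  - have [-> _] : psi N = 0 /\ f N = 0 by apply/f0/MN; rewrite gtr0_norm.
    have [-> _] : psi (- N) = 0 /\ f (- N) = 0 by apply/f0/MN; rewrite normrN gtr0_norm.
    by rewrite sube0.
  - by rewrite gtrN.
  - exact: continuous_subspaceT.
  - split => [r _||]; first exact: (@ex_derive _ _ _ _ _ _ _ (df r)).
      by apply: cvg_at_right_filter; exact: cpsi.
    by apply: cvg_at_left_filter; exact: cpsi.
  - by move=> r _; rewrite derive1E (@derive_val _ _ _ _ _ _ _ (df r)).
apply/funext => r; rewrite patchE; case: ifPn => //; rewrite notin_setE/= in_itv/= => rN.
have [_ ->] // : psi r = 0 /\ f r = 0.
apply/f0/MN; rewrite leNgt; apply/negP => /ltW; rewrite ler_norml.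
exact: rN.
Qed.

(* Fubini, integrating first in the coordinate 0 if [i] is 0, and last
   otherwise. *)
Lemma integral_partial_supp n (i : 'I_n) (psi F : 'rV[R]_n -> R) (M : R) :
  continuous F -> (forall x, is_derive x 'e_i psi (F x)) ->
  (forall x, ~ cube M x -> psi x = 0 /\ F x = 0) ->
  (\int[lebesgue_rV R n]_x (F x)%:E = 0)%E.
Proof.
elim: n i psi F => [[]//|n IHn] i psi F cF dF F0.
have iF := continuous_supp_integrable cF (fun x h => (F0 x h).2).
have mF : measurable_fun setT (EFin \o F) := measurable_int _ iF.
pose G : measurableTypeR R * 'rV[R]_n -> \bar R := fun z => (F (rV_cons z))%:E.
have mG : measurable_fun setT G.
  exact: (measurableT_comp mF (@measurable_rV_cons R n)).
have iG : (lebesgue_measure \x lebesgue_rV R n)%E.-integrable setT G.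
  apply/integrableP; split => //.
  have [_] := integrableP _ _ _ iF; apply: le_lt_trans.
  rewrite [leRHS](@ge0_integral_pushforward _ _ _ _ _ (rV_cons (n := n))
    (@measurable_rV_cons R n) (lebesgue_measure \x lebesgue_rV R n)%E)//=.
  have : measurable_fun setT (abse \o (EFin \o F)) by exact: measurableT_comp.
  by [].
rewrite [LHS](@integral_pushforward _ _ _ _ R (rV_cons (n := n)) (@measurable_rV_cons R n)
  (lebesgue_measure \x lebesgue_rV R n)%E setT (EFin \o F))//=.
rewrite preimage_setT -[LHS]/(\int[lebesgue_measure \x lebesgue_rV R n]_z G z)%E.
have [j ij|i0] := unliftP ord0 i.
- rewrite -integral12_prod_meas1//.
  rewrite (_ : fubini_F _ _ = cst 0%E) ?integral_cst ?mul0e//.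
  apply/funext => r; rewrite /fubini_F /G/=.
  (* For a fixed first coordinate [r] the slices of [psi] and [F] satisfy the same hypotheses in
     dimension [n], so the inner integral is already 0. *)
  apply: (IHn j (fun y => psi (rV_cons (r, y)))).
  + move=> y; apply: (@continuous_comp _ _ _ (fun y : 'rV[R]_n => rV_cons (r, y)) F).
      exact: rV_cons_continuousr.
    exact: cF.
  + move=> y; have := dF (rV_cons (r, y)); rewrite ij -rV_cons_e => -[dp Dp].
    have E : (fun h : R => h^-1 *: (((fun y => psi (rV_cons (r, y))) \o shift y) (h *: 'e_j)
                  - psi (rV_cons (r, y)))) =
        (fun h => h^-1 *: ((psi \o shift (rV_cons (r, y))) (h *: rV_cons (0, 'e_j))
                  - psi (rV_cons (r, y)))).
      by apply/funext => h; rewrite /= rV_cons_add.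
    by apply: DeriveDef; [rewrite /derivable E|rewrite /derive E].
  + move=> y yM; apply: F0; apply: contra_not yM => /cubeE h; apply/cubeE => k.
    by have := h (lift ord0 k); rewrite rV_consS.
- rewrite -integral21_prod_meas1//.
  rewrite (_ : fubini_G _ _ = cst 0%E) ?integral_cst ?mul0e//.
  apply/funext => y; rewrite /fubini_G /G/=.
  have cl : continuous (fun r : R => r *: 'e_ord0 + rV_cons (0, y)).
    by move=> r; apply: cvgD; [apply: cvgZr_tmp; exact: cvg_id|exact: cvg_cst].
  apply: (@integral_derive1_supp (fun r => psi (rV_cons (r, y))) _ M).
  + move=> r; under eq_fun do rewrite rV_cons_line.
    by apply: (continuous_comp (cl r)); exact: cF.
  + move=> r; rewrite rV_cons_line; under eq_fun do rewrite rV_cons_line.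
    have [dp <-] := dF (r *: 'e_ord0 + rV_cons (0, y)).
    by rewrite i0 in dp *; exact: is_derive_line.
  + move=> r rM; apply: F0 => /cubeE/(_ ord0); rewrite rV_cons0/=.
    by rewrite leNgt rM.
Qed.

End divergence.

(** * Integration by parts against test functions *)

Section by_parts.
Context (R : realType) (n : nat).
Implicit Types (U V : set 'rV[R]_n) (w phi h : 'rV[R]_n -> R).
Local Notation mu := (lebesgue_rV R n).

(** The complement of the support is open. A product with [phi] is therefore locally 0 at every
    point outside [V], whatever the other factor does there. *)
Lemma test_fun_near0 k V phi x : test_fun k V phi -> ~ V x ->
  \forall y \near x, phi y = 0.
Proof.
move=> [_ _ SV] nVx; have : (~` closure [set x | phi x != 0]) x by move=> /SV.
move=> nS; have : nbhs x (~` closure [set x | phi x != 0]).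
  by apply: open_nbhs_nbhs; split => //; apply: closed_openC; exact: closed_closure.
apply: filterS => y nSy; apply/eqP; apply/negPn/negP => y0.
by apply: nSy; exact: subset_closure.
Qed.

Lemma test_fun_partial k V phi i : test_fun k.+1 V phi -> test_fun k V (partial i phi).
Proof.
move=> [[_ /(_ i)[_ Cp]] cS SV].
have sub : closure [set x | partial i phi x != 0] `<=` closure [set x | phi x != 0].
  rewrite [X in X `<=` _]closureE; apply: smallest_sub; first exact: closed_closure.
  move=> x /= /eqP; apply: contra_notP => nS; rewrite -(derive_cst (0 : R) x 'e_i).
  apply: near_eq_derive; have : nbhs x (~` closure [set x | phi x != 0]).
    by apply: open_nbhs_nbhs; split => //; apply: closed_openC; exact: closed_closure.
  apply: filterS => y nSy; apply/eqP; apply/negPn/negP => y0.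
  by apply: nSy; exact: subset_closure.
split => //; last exact: subset_trans SV.
by apply: subclosed_compact sub; first exact: closed_closure.
Qed.

Lemma test_fun_cube k V phi : test_fun k V phi ->
  exists M : R, forall x, ~ cube M x -> phi x = 0.
Proof.
move=> [_ /compact_sub_cube[M SM] _]; exists M => x.
by apply: contra_notP => /eqP phi0; apply: SM; exact: subset_closure.
Qed.

Lemma continuous_test_mul k V w phi : open V -> test_fun k V phi ->
  (forall x, V x -> {for x, continuous w}) -> continuous (fun x => w x * phi x).
Proof.
move=> oV tphi cw x; have [Vx|nVx] := pselect (V x).
  apply: continuousM; first exact: cw.
  by case: tphi => Cphi _ _; exact: Ck_continuous Cphi _.
have c0 : {for x, continuous (fun=> 0 : R)} by exact: cst_continuous.
apply: near_eq_continuous c0; apply: filterS (test_fun_near0 tphi nVx) => y ->.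
by rewrite mulr0.
Qed.

Lemma test_mul_integrable k V w phi : open V -> test_fun k V phi ->
  (forall x, V x -> {for x, continuous w}) ->
  mu.-integrable setT (EFin \o (fun x => w x * phi x)).
Proof.
move=> oV tphi cw; have [M phi0] := test_fun_cube tphi.
apply: (continuous_supp_integrable (M := M)).
  exact: continuous_test_mul oV tphi cw.
by move=> x /phi0 ->; rewrite mulr0.
Qed.

(** The product [w * phi] vanishes outside a cube and is differentiable along ['e_i] on the whole
    space, since it is locally 0 outside [V]. The integral of its derivative is therefore 0, with no
    boundary term. *)
Lemma integration_by_parts_rV V w phi i : open V -> Ck 1 V w -> test_fun 1 V phi ->
  \int[mu]_x (w x * partial i phi x) = - \int[mu]_x (partial i w x * phi x).
Proof.
move=> oV Cw tphi.
have tp := test_fun_partial i tphi.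
have [_ /(_ i)[dw Cw']] := Cw.
have cw x : V x -> {for x, continuous w} by exact: Ck_continuous Cw.
have cw' x : V x -> {for x, continuous (partial i w)} by case: Cw' => + _; exact.
apply/eqP; rewrite -addr_eq0; apply/eqP; rewrite -RintegralD//=; last 2 first.
- exact: test_mul_integrable oV tp cw.
- exact: test_mul_integrable oV tphi cw'.
(* The larger of the two radii gives one cube outside which both [phi] and its derivative vanish. *)
have [M phi0] := test_fun_cube tphi; have [M' phi0'] := test_fun_cube tp.
suff h0 : (\int[mu]_x (w x * partial i phi x + partial i w x * phi x)%:E = 0)%E.
  by rewrite /Rintegral h0.
apply: (@integral_partial_supp _ _ i (fun x => w x * phi x) _ (Num.max M M')).
- move=> x; apply: (@continuousD _ _ _ (fun x => w x * partial i phi x)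
      (fun x => partial i w x * phi x)).
    exact: (continuous_test_mul oV tp cw).
  exact: (continuous_test_mul oV tphi cw').
- move=> x; have [Vx|nVx] := pselect (V x).
    have [[_ /(_ i)[dphi _]] _ _] := tphi.
    have dwx := dw x Vx; have dphix := dphi x I.
    apply: DeriveDef; first exact: (derivableM dwx dphix).
    by rewrite (deriveM dwx dphix) [_ *: partial i w x]mulrC.
  have n0 := test_fun_near0 tphi nVx; have n0' := test_fun_near0 tp nVx.
  rewrite (nbhs_singleton n0) (nbhs_singleton n0') !mulr0 addr0.
  have d0 : is_derive x 'e_i (fun=> 0 : R) 0 by exact: is_derive_cst.
  by apply: near_eq_is_derive d0; apply: filterS n0 => y ->; rewrite mulr0.
- move=> x xM; rewrite phi0 ?phi0' ?mulr0 ?addr0//.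
    apply: contra_not xM => /cubeE h; apply/cubeE => k.
    by rewrite le_max h orbT.
  by apply: contra_not xM => /cubeE h; apply/cubeE => k; rewrite le_max h.
Qed.

(** The outermost derivative moves first, which reverses the order of [i] and [j] on [w]. *)
Lemma by_parts2 V w phi i j : open V -> Ck 2 V w -> test_fun 2 V phi ->
  \int[mu]_x (w x * partial i (partial j phi) x) =
  \int[mu]_x (partial j (partial i w) x * phi x).
Proof.
move=> oV Cw tphi.
rewrite (integration_by_parts_rV i oV (CkW Cw) (test_fun_partial j tphi)).
have [_ /(_ i)[_ Cw']] := Cw.
have tphi1 : test_fun 1 V phi by have [Cphi cS SV] := tphi; split => //; exact: CkW.
by rewrite (integration_by_parts_rV j oV Cw' tphi1) opprK.
Qed.

End by_parts.

(** * Weak and classical derivatives *)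

Section weak_derivatives.
Context (R : realType) (n : nat).
Implicit Types (U V : set 'rV[R]_n) (v w g phi : 'rV[R]_n -> R).
Local Notation mu := (lebesgue_rV R n).

Lemma foldr_partial0 (alpha : 'I_n -> nat) (s : seq 'I_n) phi :
  (forall k, k \in s -> alpha k = 0%N) ->
  foldr (fun i => iter (alpha i) (partial i)) phi s = phi.
Proof.
elim: s => //= k s IHs a0; rewrite IHs ?a0 ?mem_head// => l ls.
by apply: a0; rewrite in_cons ls orbT.
Qed.

Lemma foldr_partial1 (alpha : 'I_n -> nat) (s : seq 'I_n) phi i : uniq s ->
  i \in s -> (forall k, k \in s -> k != i -> alpha k = 0%N) ->
  foldr (fun i => iter (alpha i) (partial i)) phi s = iter (alpha i) (partial i) phi.
Proof.
move=> us /splitPr s12; case: s12 us => s1 s2.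
rewrite cat_uniq/= negb_or => /and3P[_ /andP[is1 _] /andP[is2 _]] a0.
rewrite foldr_cat/= !foldr_partial0// => k ks; apply: a0.
- by rewrite mem_cat inE ks !orbT.
- by apply: contraNneq is2 => <-.
- by rewrite mem_cat ks.
- by apply: contraNneq is1 => <-.
Qed.

(** The values are in ['I_3] because the Sobolev norms of order 2 range over such multi-indices; the
    value 2, reached when [i = j], still fits. *)
Definition pair_index (i j : 'I_n) : {ffun 'I_n -> 'I_3} :=
  [ffun k => inord ((k == i) + (k == j))].

Lemma pair_indexE i j k : pair_index i j k = ((k == i) + (k == j))%N :> nat.
Proof. by rewrite ffunE inordK//; case: (k == i); case: (k == j). Qed.

Lemma sum_pair_index i j : (\sum_k pair_index i j k = 2)%N.
Proof.
under eq_bigr do rewrite pair_indexE.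
rewrite big_split/=.
have s1 (l : 'I_n) : (\sum_(k < n) (k == l) = 1)%N.
  by rewrite (bigD1 l)//= eqxx big1 ?addn0// => k /negbTE ->.
by rewrite !s1.
Qed.

(** [Dmulti] differentiates in an order dictated by [enum 'I_n]. Since [phi] is arbitrary the
    derivatives cannot be exchanged here, and the disjunction leaves the relative position of [i]
    and [j] open. *)
Lemma Dmulti_pair_index i j phi :
  Dmulti (fun k => pair_index i j k) phi = partial i (partial j phi) \/
  Dmulti (fun k => pair_index i j k) phi = partial j (partial i phi).
Proof.
rewrite /Dmulti; have := enum_uniq 'I_n; have := mem_enum 'I_n i.
have := mem_enum 'I_n j; move: (enum 'I_n) => s /= js is_ us.
have [ij|ij] := eqVneq i j.
  left; rewrite (@foldr_partial1 _ _ phi i us is_); last first.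
    by move=> k _ ki; rewrite pair_indexE -ij (negbTE ki).
  by rewrite pair_indexE ij eqxx.
have ai : pair_index i j i = 1%N :> nat by rewrite pair_indexE eqxx (negbTE ij).
have aj : pair_index i j j = 1%N :> nat by rewrite pair_indexE eqxx eq_sym (negbTE ij).
have a0 k : k != i -> k != j -> pair_index i j k = 0%N :> nat.
  by move=> ki kj; rewrite pair_indexE (negbTE ki) (negbTE kj).
move: is_ js us => /splitPr s12; case: s12 => s1 s2.
rewrite mem_cat inE eq_sym (negbTE ij)/= cat_uniq/= negb_or => js.
move=> /and3P[us1 /andP[is1 /hasPn s12] /andP[is2 us2]].
have nei k (s' : seq 'I_n) : i \notin s' -> k \in s' -> k != i.
  by move=> h ks; apply: contraNneq h => <-.
case/orP: js => js.
- right; have js2 : j \notin s2 by apply: contraL js => /s12.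
  rewrite foldr_cat/= ai/= (@foldr_partial0 _ s2) => [|k ks]; last first.
    by apply: a0; [exact: nei is2 ks|apply: contraNneq js2 => <-].
  rewrite (@foldr_partial1 _ _ _ j us1 js) ?aj// => k ks kj.
  by apply: a0 => //; exact: nei is1 ks.
- left; have js1 : j \notin s1 by exact: s12.
  rewrite foldr_cat/= ai/= (@foldr_partial1 _ _ _ j us2 js) ?aj/=; last first.
    by move=> k ks kj; apply: a0 => //; exact: nei is2 ks.
  rewrite foldr_partial0// => k ks.
  by apply: a0; [exact: nei is1 ks|apply: contraNneq js1 => <-].
Qed.

(** The norm of exponent [+oo] is the essential supremum only on a space of positive measure; an
    open unit box witnesses this. *)
Lemma Lp_norm_y U g : Lp_norm +oo%E U g = ess_sup mu (abse \o (EFin \o (g \_ U))).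
Proof.
rewrite /Lp_norm unlock ifT//.
apply: (@lt_le_trans _ _ (mu (obox (const_mx 0) (const_mx 1)))).
  by apply: obox_mu_gt0 => i; rewrite !mxE.
by apply: le_measure; rewrite ?inE//; exact: measurable_obox.
Qed.

Lemma Lp_norm_y_ae U g (B : \bar R) : (Lp_norm +oo U g <= B)%E ->
  {ae mu, forall x, U x -> (`|g x|%:E <= B)%E}.
Proof.
rewrite Lp_norm_y => /ess_supP; apply: filterS => x /= h Ux.
by move: h; rewrite patchE mem_set.
Qed.

Lemma eq_Lp_norm_y U g g' : {ae mu, forall x, U x -> g x = g' x} ->
  Lp_norm +oo%E U g = Lp_norm +oo%E U g'.
Proof.
rewrite !Lp_norm_y => gg'; apply: eq_ess_sup; apply: filterS gg' => x h /=.
by rewrite !patchE; case: ifPn => // /set_mem/h ->.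
Qed.

Lemma continuous_on_compact_integrable U K w : open U -> compact K -> K `<=` U ->
  (forall x, U x -> {for x, continuous w}) -> mu.-integrable K (EFin \o w).
Proof.
move=> oU cK KU cw.
have clK : closed K by apply: compact_closed => //; exact: norm_hausdorff.
have mK := closed_measurable_rV clK.
apply: measurable_bounded_integrable => //.
- exact: compact_measure_lty.
- apply: (measurable_funS (open_measurable_rV oU) KU).
  exact: continuous_on_measurable.
- apply: compact_image_bounded => //; apply: continuous_in_subspaceT => x.
  by rewrite inE => /KU; exact: cw.
Qed.

Lemma continuous_locally_integrable U w : open U ->
  (forall x, U x -> {for x, continuous w}) -> locally_integrable_on U w.
Proof.
move=> oU cw; split; first exact: continuous_on_measurable.
move=> K cK KU.
by have /integrableP[] := continuous_on_compact_integrable oU cK KU cw.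
Qed.

Lemma locally_integrable_onB U v w : open U -> locally_integrable_on U v ->
  locally_integrable_on U w -> locally_integrable_on U (fun x => v x - w x).
Proof.
move=> oU lv lw; split; first by apply: measurable_funB; [case: lv|case: lw].
move=> K cK KU.
have mK : measurable K.
  by apply: closed_measurable_rV; apply: compact_closed => //; exact: norm_hausdorff.
have mU := open_measurable_rV oU.
have /integrableP[_]// := integrableB mK (locally_integrable_compact mU lv cK KU)
  (locally_integrable_compact mU lw cK KU).
Qed.

Lemma locally_integrable_on_subset U V v : open U -> V `<=` U ->
  locally_integrable_on U v -> locally_integrable_on V v.
Proof.
move=> oU VU [mv iv]; split; last by move=> K cK KV; apply: iv => //; exact: subset_trans VU.
exact: (measurable_funS (open_measurable_rV oU) VU mv).
Qed.

Lemma Rintegral_supp U (F : 'rV[R]_n -> R) : (forall x, ~ U x -> F x = 0) ->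
  \int[mu]_(x in U) F x = \int[mu]_x F x.
Proof.
move=> F0; rewrite Rintegral_mkcond; congr (Rintegral _ _ _).
apply/funext => x; rewrite patchE; case: ifPn => //.
by rewrite notin_setE => /F0 ->.
Qed.

Lemma test_fun_out k U phi x : test_fun k U phi -> ~ U x -> phi x = 0.
Proof. by move=> tp nUx; have := nbhs_singleton (test_fun_near0 tp nUx). Qed.

Lemma test_fun_subset k U V phi : U `<=` V -> test_fun k U phi -> test_fun k V phi.
Proof. by move=> UV [Cp cS SU]; split => //; exact: subset_trans UV. Qed.

(** On the compact support of [phi], [v] is integrable and [phi] bounded; elsewhere the product is
    0. *)
Lemma locally_integrable_test k U v phi : open U -> locally_integrable_on U v ->
  test_fun k U phi -> mu.-integrable U (EFin \o (fun x => v x * phi x)).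
Proof.
move=> oU lv tphi; have [Cphi cS SU] := tphi.
have mU := open_measurable_rV oU.
pose S := closure [set x | phi x != 0].
have mS : measurable S by apply: closed_measurable_rV; exact: closed_closure.
have cphi : continuous phi by move=> x; exact: (Ck_continuous Cphi).
have iS : mu.-integrable S (EFin \o (fun x => v x * phi x)).
  apply: (@integrableMl _ _ _ mu S mS (EFin \o v) phi).
  - exact: locally_integrable_compact mU lv cS SU.
  - by apply: measurable_funTS; exact: continuous_measurable_rV.
  - by apply: compact_image_bounded => //; exact: continuous_subspaceT.
apply/(integrable_mkcond _ mU).
have -> : (EFin \o (fun x => v x * phi x)) \_ U = (EFin \o (fun x => v x * phi x)) \_ S.
  apply/funext => x; rewrite !patchE.
  have [xS|xS] := pselect (S x); first by rewrite !mem_set//; exact: SU.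
  rewrite [in RHS]ifF; last by apply/negbTE; rewrite notin_setE.
  have p0 : phi x = 0.
    by apply/eqP/negPn/negP => p0; apply: xS; exact: subset_closure.
  by case: ifP => // _; rewrite /= p0 mulr0.
exact/(integrable_mkcond _ mS).
Qed.

(** The difference integrates to 0 against every test function of class C^a, where [a] is the order
    of [alpha]; this is why the du Bois-Reymond lemma is available for every finite class. *)
Lemma weak_deriv_unique U alpha v g g' : open U -> weak_deriv U alpha v g ->
  weak_deriv U alpha v g' -> {ae mu, forall x, U x -> g x = g' x}.
Proof.
move=> oU; rewrite /weak_deriv; set a := (\sum_i alpha i)%N.
move=> [_ lg gE] [_ lg' gE'].
have : {ae mu, forall x, U x -> g x - g' x = 0}.
  apply: (du_Bois_Reymond (k := a) oU); first exact: locally_integrable_onB.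
  move=> phi tphi.
  under eq_Rintegral do rewrite mulrBl.
  rewrite RintegralB//=; last 3 first.
  - exact: open_measurable_rV.
  - exact: locally_integrable_test oU lg tphi.
  - exact: locally_integrable_test oU lg' tphi.
  have := gE _ tphi; rewrite (gE' _ tphi).
  have s0 : (-1 : R) ^+ a != 0 by rewrite signr_eq0.
  by move/(mulfI s0) ->; rewrite subrr.
by apply: filterS => x h /h /eqP; rewrite subr_eq0 => /eqP.
Qed.

(** Test functions on [V] are test functions on [U], so on [V] both [g] and the classical derivative
    of [w] are weak derivatives of [v] and agree almost everywhere. Continuity then turns the
    essential bound into a bound at every point of [V]. *)
Lemma weak_deriv2_bound U V v w g (B : R) i j : open U -> open V -> V `<=` U ->
  Ck 2 V w -> (forall x, V x -> v x = w x) ->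
  weak_deriv U (fun k => pair_index i j k) v g -> (Lp_norm +oo U g <= B%:E)%E ->
  forall x, V x -> `|partial i (partial j w) x| <= B.
Proof.
move=> oU oV VU Cw vw; rewrite /weak_deriv sum_pair_index => -[_ lg gE] gB x Vx.
pose h := partial i (partial j w).
have ch y : V y -> {for y, continuous h}.
  by move=> Vy; have [_ /(_ j)[_ [_ /(_ i)[_ [+ _]]]]] := Cw; exact.
have lh := continuous_locally_integrable oV ch.
have lgV := locally_integrable_on_subset oU VU lg.
have mV := open_measurable_rV oV.
have gh : {ae mu, forall y, V y -> g y - h y = 0}.
  apply: (du_Bois_Reymond (k := 2) oV); first exact: locally_integrable_onB.
  move=> phi tphi; under eq_Rintegral do rewrite mulrBl.
  rewrite RintegralB//=; last 2 first.
  - exact: locally_integrable_test oV lgV tphi.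
  - exact: locally_integrable_test oV lh tphi.
  have := gE _ (test_fun_subset VU tphi); rewrite sqrrN expr1n mul1r.
  have out := test_fun_out tphi.
  have tphi2 k l := test_fun_partial k (test_fun_partial l tphi).
  rewrite [X in _ = X -> _]Rintegral_supp; last first.
    by move=> y nUy; rewrite out ?mulr0// => /VU.
  rewrite [X in _ -> X - _ = _]Rintegral_supp; last first.
    by move=> y nVy; rewrite out ?mulr0.
  move=> <-.
  rewrite [X in _ - X = _]Rintegral_supp; last first.
    by move=> y nVy; rewrite out ?mulr0.
  have E k l : \int[mu]_(x in U) (v x * partial k (partial l phi) x) =
      \int[mu]_x (partial l (partial k w) x * phi x).
    rewrite -(by_parts2 k l oV Cw tphi) Rintegral_supp; last first.
      move=> y nUy; rewrite (test_fun_out (tphi2 k l)) ?mulr0//.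
      by move=> /VU.
    apply: eq_Rintegral => y _; have [/vw ->//|nVy] := pselect (V y).
    by rewrite (test_fun_out (tphi2 k l)) ?mulr0.
  apply/eqP; rewrite subr_eq0; apply/eqP.
  case: (Dmulti_pair_index i j phi) => ->; last exact: E.
  rewrite (E i j); apply: eq_Rintegral => y _.
  have mul_out (b c e : R) : e = 0 -> b * e = c * e by move=> ->; rewrite !mulr0.
  have [Vy|nVy] := pselect (V y); last by apply: mul_out; exact: out.
  by rewrite (partialC j i oV Cw Vy).
(* If the bound failed at [x] it would fail on a whole box around [x]. This box would be covered by
   two null sets, although its measure is positive. *)
rewrite leNgt; apply/negP => Bh.
have oW : open (V `&` [set y | B < `|h y|]).
  rewrite openE => y [Vy By]; apply: filterI; first exact: open_nbhs_nbhs.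
  have cn : {for y, continuous (fun y => `|h y|)}.
    by apply: continuous_comp; [exact: ch|exact: norm_continuous].
  by apply: (cn [set z | B < z]); apply: open_nbhs_nbhs; split => //; exact: open_gt.
have [q [xq qW]] := open_rat_box oW (conj Vx Bh).
set Q := obox _ _ in xq.
have Q0 : (0 < mu Q)%E.
  by apply: obox_mu_gt0 => k; have /andP[qx xq'] := xq k; exact: lt_trans qx xq'.
have : mu.-negligible Q.
  have [N [mN N0 hN]] := Lp_norm_y_ae gB.
  have [N' [mN' N0' hN']] := gh.
  exists (N `|` N'); split; [exact: measurableU| |].
    by apply: null_set_setU.
  move=> y /obox_cbox/qW[Vy /= By]; have [Ny|nNy] := pselect (N y); [by left|right].
  apply: hN' => /= /(_ Vy)/eqP; rewrite subr_eq0 => /eqP ghy.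
  apply: nNy; apply: hN => /= /(_ (VU _ Vy)); rewrite lee_fin ghy.
  by rewrite leNgt By.
move=> /negligibleP; rewrite /Q => /(_ (measurable_obox _ _)) Q00.
by move: Q0; rewrite /Q Q00 ltxx.
Qed.

Lemma in_sobolev_wderiv k p U v (alpha : {ffun 'I_n -> 'I_k.+1}) :
  in_sobolev k p U v -> (\sum_i alpha i <= k)%N ->
  weak_deriv U (fun i => alpha i) v (wderiv U (fun i => alpha i) v).
Proof.
by move=> sv /sv[g [wg _]]; rewrite /wderiv; apply: xgetPex; exists g.
Qed.

(** The norm is [+oo] outside the Sobolev space, so a finite bound includes membership, and this
    makes [wderiv] a genuine weak derivative rather than its default value. *)
Lemma sobolev_norm2_deriv U v (B : R) i j :
  (sobolev_norm 2 +oo U v <= B%:E)%E ->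
  exists2 g, weak_deriv U (fun k => pair_index i j k) v g &
    (Lp_norm +oo U g <= B%:E)%E.
Proof.
rewrite /sobolev_norm; case: asboolP => [sv|_]; last by rewrite leNgt ltry.
move=> /bigmax_leP[_ h]; have s2 := sum_pair_index i j.
exists (wderiv U (fun k => pair_index i j k) v).
  by apply: in_sobolev_wderiv sv _; rewrite s2.
by apply: h; rewrite s2.
Qed.

Lemma sobolev_seminorm2_deriv U v (B : R) i j :
  (sobolev_seminorm 2 +oo U v <= B%:E)%E ->
  exists2 g, weak_deriv U (fun k => pair_index i j k) v g &
    (Lp_norm +oo U g <= B%:E)%E.
Proof.
rewrite /sobolev_seminorm; case: asboolP => [sv|_]; last by rewrite leNgt ltry.
move=> /bigmax_leP[_ h]; have s2 := sum_pair_index i j.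
exists (wderiv U (fun k => pair_index i j k) v).
  by apply: in_sobolev_wderiv sv _; rewrite s2.
by apply: h; rewrite s2.
Qed.

(* [in_sobolev] bounds some weak derivative whereas the seminorm uses the one
   chosen by [wderiv]: uniqueness is needed. *)
Lemma sobolev_seminorm_y_finite k U v : open U -> in_sobolev k +oo U v ->
  exists2 N : R, 0 <= N & (sobolev_seminorm k +oo U v = N%:E)%E.
Proof.
move=> oU sv; rewrite /sobolev_seminorm; case: asboolP => // _ /=.
set S := (\big[maxe/0%E]_(alpha | _) _).
have S0 : (0 <= S)%E by exact: bigmax_ge_id.
have Sy : (S < +oo)%E.
  apply/bigmax_ltP; split => // alpha /eqP ak.
  have [|g [wg gy]] := sv alpha; first by rewrite ak.
  rewrite -(eq_Lp_norm_y (g := g))//.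
  apply: (weak_deriv_unique oU wg); apply: in_sobolev_wderiv sv _.
  by rewrite ak.
exists (fine S); first exact: fine_ge0.
by rewrite fineK// ge0_fin_numE.
Qed.

End weak_derivatives.

(** * Extreme eigenvalues of symmetric matrices *)

Section rayleigh.
Context (R : realType) (n : nat).
Implicit Types (A B P : 'M[R]_n) (x y z : 'rV[R]_n).

Definition qform A x y : R := (x *m A *m y^T) 0 0.
Definition sqn x : R := \sum_i x 0 i ^+ 2.

Lemma qformE A x y : qform A x y = \sum_i \sum_j x 0 i * A i j * y 0 j.
Proof.
rewrite /qform mxE exchange_big/=; apply: eq_bigr => j _.
by rewrite mxE mulr_suml; apply: eq_bigr => i _; rewrite mxE.
Qed.

Lemma qform_sub A B x y : qform (A - B) x y = qform A x y - qform B x y.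
Proof. by rewrite /qform mulmxBr mulmxBl mxE [X in _ + X]mxE. Qed.

Lemma qform_scalar (a : R) x : qform (a%:M) x x = a * sqn x.
Proof.
rewrite /qform mul_mx_scalar -scalemxAl mxE mxE; congr (_ * _).
by apply: eq_bigr => i _; rewrite mxE expr2.
Qed.

Lemma qform_sym A x y : A^T = A -> qform A x y = qform A y x.
Proof.
move=> sA; rewrite /qform -[in RHS](trmxK (y *m A *m x^T)) [RHS]mxE.
by rewrite !trmx_mul trmxK sA mulmxA.
Qed.

Lemma qform_line A x z (t : R) : A^T = A ->
  qform A (x + t *: z) (x + t *: z) =
  qform A x x + t * qform A z x *+ 2 + t ^+ 2 * qform A z z.
Proof.
move=> sA.
have -> : qform A (x + t *: z) (x + t *: z) =
    qform A x x + t * qform A x z + t * qform A z x + t * t * qform A z z.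
  rewrite /qform linearD linearZ/= !mulmxDl !mulmxDr -!scalemxAl -!scalemxAr scalerA.
  by rewrite !mxE; ring.
by rewrite (qform_sym x z sA) expr2; ring.
Qed.

Lemma qformZ A (a : R) x : qform A (a *: x) (a *: x) = a ^+ 2 * qform A x x.
Proof.
by rewrite /qform linearZ/= -!scalemxAl -!scalemxAr scalerA mxE expr2.
Qed.

Lemma sqnZ (a : R) x : sqn (a *: x) = a ^+ 2 * sqn x.
Proof. by rewrite /sqn mulr_sumr; apply: eq_bigr => i _; rewrite mxE exprMn. Qed.

Lemma sqn_gt0 x : x != 0 -> 0 < sqn x.
Proof.
move=> x0; rewrite lt_neqAle sumr_ge0 ?andbT => [|i _]; last exact: sqr_ge0.
apply: contra x0 => /eqP/esym/eqP.
rewrite psumr_eq0 => [/allP h|i _]; last exact: sqr_ge0.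
apply/eqP/rowP => i; rewrite mxE; apply/eqP.
by rewrite -sqrf_eq0; apply: (h i); rewrite mem_index_enum.
Qed.

Lemma polynomial_qform A : polynomial (fun x => qform A x x).
Proof.
under eq_fun do rewrite qformE.
apply: polynomial_sum => i _; apply: polynomial_sum => j _.
apply: polynomial_mul; last exact: polynomial_coord.
by apply: polynomial_mul; [exact: polynomial_coord|exact: polynomial_cst].
Qed.

Lemma polynomial_continuous (f : 'rV[R]_n -> R) : polynomial f -> continuous f.
Proof. by move=> pf x; exact/differentiable_continuous/polynomial_differentiable. Qed.

Lemma polynomial_sqn : polynomial sqn.
Proof.
have -> : sqn = fun x => \sum_i x 0 i * x 0 i by [].
apply: polynomial_sum => i _.
by apply: polynomial_mul; exact: polynomial_coord.
Qed.

Lemma compact_sphere : compact [set x | sqn x = 1].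
Proof.
apply: bounded_closed_compact.
  exists 1; split => // M M1 x /= x1; apply: le_trans (ltW M1).
  rewrite [leLHS]/Num.Def.normr/= mx_normrE; apply/bigmax_leP; split => // -[k i] _ /=.
  rewrite [k]ord1 -(expr_le1 (n := 2))// real_normK ?num_real//.
  rewrite -x1 /sqn (bigD1 i)//= lerDl sumr_ge0// => j _; exact: sqr_ge0.
rewrite (_ : [set x | sqn x = 1] = sqn @^-1` [set 1])//.
apply: closed_comp => [x _|]; last exact: closed_eq.
exact/polynomial_continuous/polynomial_sqn.
Qed.

(* A minimiser of the Rayleigh quotient is an eigenvector, because the first
   variation of the quadratic form of [A - mu] vanishes there. *)
Lemma min_eigenvalue A : (0 < n)%N -> A^T = A ->
  exists2 mu, eigenvalue A mu & forall y, mu * sqn y <= qform A y y.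
Proof.
move=> n0 sA.
have S0 : [set x | sqn x = 1] !=set0.
  exists ('e_(Ordinal n0)) => /=; rewrite /sqn (bigD1 (Ordinal n0))//= big1.
    by rewrite mxE !eqxx expr1n addr0.
  by move=> i /negbTE i0; rewrite mxE i0 andbF expr0n.
have [|x0 x01 xmin] := compact_EVT_min (f := fun x => qform A x x) S0 compact_sphere.
  apply: continuous_subspaceT; exact/polynomial_continuous/polynomial_qform.
move: x01; rewrite inE/= => x01.
pose mu := qform A x0 x0.
have mu_le y : mu * sqn y <= qform A y y.
  have [->|y0] := eqVneq y 0.
    have -> : sqn 0 = 0 by rewrite /sqn big1// => i _; rewrite mxE expr0n.
    by rewrite mulr0 /qform mul0mx mul0mx mxE.
  have sy := sqn_gt0 y0; pose a := (Num.sqrt (sqn y))^-1.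
  have aa : a ^+ 2 = (sqn y)^-1 by rewrite exprVn sqr_sqrtr// ltW.
  have := xmin (a *: y); rewrite inE/= sqnZ aa mulVf ?gt_eqF// => /(_ erefl).
  by rewrite qformZ aa mulrC ler_pdivlMr.
exists mu => //; apply/eigenvalueP; exists x0; last first.
  apply/eqP => x00; move: x01; rewrite x00 /sqn big1 => [/esym/eqP|i _].
    by rewrite oner_eq0.
  by rewrite mxE expr0n.
pose B := A - mu%:M; have sB : B^T = B by rewrite linearB/= tr_scalar_mx sA.
have B0 y : 0 <= qform B y y by rewrite qform_sub qform_scalar subr_ge0.
have Bx0 : qform B x0 x0 = 0 by rewrite qform_sub qform_scalar x01 mulr1 subrr.
have Bz z : qform B z x0 = 0.
  (* With [b = qform B z x0] and [c = qform B z z], this displacement gives the form the value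
     [- b ^+ 2 * (c + 2) / (c + 1) ^+ 2], so positivity forces [b = 0]. The denominator is [c + 1]
     because [c] may be 0. *)
  have := B0 (x0 + (- qform B z x0 / (qform B z z + 1)) *: z).
  have := B0 z; rewrite qform_line// Bx0 add0r.
  move: (qform B z x0) (qform B z z) => b c c0.
  have c1 : 0 < c + 1 by rewrite ltr_wpDl.
  have -> : - b / (c + 1) * b *+ 2 + (- b / (c + 1)) ^+ 2 * c =
            - (b ^+ 2 * (c + 2) / (c + 1) ^+ 2).
    by field; rewrite gt_eqF.
  rewrite oppr_ge0 pmulr_lle0 ?invr_gt0 ?exprn_gt0// pmulr_lle0 ?ltr_wpDl//.
  by move=> b0; apply/eqP; rewrite -sqrf_eq0 eq_le b0 sqr_ge0.
apply/eqP; rewrite -subr_eq0 -mul_mx_scalar -mulmxBr -/B.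
apply/eqP/rowP => i; rewrite [RHS]mxE -(Bz 'e_i) (qform_sym _ _ sB) /qform.
have ei j : ('e_i : 'rV[R]_n)^T j 0 = (j == i)%:R by rewrite !mxE eqxx.
rewrite [RHS]mxE (bigD1 i)//= ei eqxx mulr1 [X in _ + X]big1 ?addr0//.
by move=> j /negbTE ji; rewrite ei ji mulr0.
Qed.

Lemma eigenvalue_qform A a : eigenvalue A a ->
  exists2 x, x != 0 & qform A x x = a * sqn x.
Proof.
move=> /eigenvalueP[x xA x0]; exists x => //.
rewrite /qform xA -scalemxAl mxE mxE; congr (_ * _).
by apply: eq_bigr => i _; rewrite mxE expr2.
Qed.

Lemma eigenvalue_bounds A a b e : eigenvalue A e ->
  (forall y, a * sqn y <= qform A y y <= b * sqn y) -> a <= e <= b.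
Proof.
move=> /eigenvalue_qform[x /sqn_gt0 x0 xe] /(_ x).
by rewrite xe !ler_pM2r.
Qed.

Lemma eigenvalueN A a : eigenvalue (- A) a -> eigenvalue A (- a).
Proof.
move=> /eigenvalueP[x xA x0]; apply/eigenvalueP; exists x => //.
by rewrite scaleNr -xA mulmxN opprK.
Qed.

Lemma max_eigenvalue A : (0 < n)%N -> A^T = A ->
  exists2 nu, eigenvalue A nu & forall y, qform A y y <= nu * sqn y.
Proof.
move=> n0 sA; have [|mu muA mule] := @min_eigenvalue (- A) n0.
  by rewrite linearN/= sA.
exists (- mu); first exact: eigenvalueN.
move=> y; have := mule y; rewrite mulNr lerNr.
by rewrite /qform mulmxN mulNmx [X in _ <= X -> _]mxE.
Qed.

(** An [inf] or [sup] is informative only for a nonempty bounded set: [mu] and [nu], which satisfy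
    the Rayleigh bounds, are eigenvalues and enclose all others. *)
Lemma lambda_qform A y : (0 < n)%N -> A^T = A ->
  lambda_min A * sqn y <= qform A y y <= lambda_max A * sqn y.
Proof.
move=> n0 sA; have [mu muA mule] := min_eigenvalue n0 sA.
have [nu nuA lenu] := max_eigenvalue n0 sA.
have sq0 : 0 <= sqn y by apply: sumr_ge0 => i _; exact: sqr_ge0.
have h e : eigenvalue A e -> mu <= e <= nu.
  by move=> eA; apply: (eigenvalue_bounds eA) => z; rewrite mule lenu.
apply/andP; split.
  apply: le_trans (mule y); apply: ler_wpM2r => //.
  by apply: ge_inf => //; exists mu => e /h/andP[].
apply: le_trans (lenu y) _; apply: ler_wpM2r => //.
by apply: ub_le_sup => //; exists nu => e /h/andP[].
Qed.

Lemma lambda_bounds A a b : (0 < n)%N -> A^T = A ->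
  (forall y, a * sqn y <= qform A y y <= b * sqn y) ->
  [/\ a <= lambda_min A, lambda_min A <= lambda_max A & lambda_max A <= b].
Proof.
move=> n0 sA ab; have [mu muA _] := min_eigenvalue n0 sA.
have h e : eigenvalue A e -> a <= e <= b by move=> eA; exact: eigenvalue_bounds ab.
have hl : has_lbound [set e | eigenvalue A e] by exists a => e /h/andP[].
have hu : has_ubound [set e | eigenvalue A e] by exists b => e /h/andP[].
split.
- by apply: lb_le_inf; [exists mu|move=> e /h/andP[]].
- by apply: (@le_trans _ _ mu); [exact: ge_inf|exact: ub_le_sup].
- by apply: ge_sup; [exists mu|move=> e /h/andP[]].
Qed.

(** Each product [|y 0 i| * |y 0 j|] is at most half the sum of the squares, and each square is then
    counted [n] times. This is the origin of the factor [n] in the bound on [delta]. *)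
Lemma qform_entry_bound A (e : R) y : (forall i j, `|A i j| <= e) ->
  `|qform A y y| <= e * n%:R * sqn y.
Proof.
move=> Ae; rewrite qformE; apply: le_trans (ler_norm_sum _ _ _) _.
apply: (@le_trans _ _ (\sum_i \sum_j e * ((y 0 i ^+ 2 + y 0 j ^+ 2) / 2))).
  apply: ler_sum => i _; apply: le_trans (ler_norm_sum _ _ _) _.
  apply: ler_sum => j _; rewrite !normrM mulrAC mulrC.
  apply: ler_pM => //.
  have := sqr_ge0 (`|y 0 i| - `|y 0 j|).
  rewrite sqrrB !real_normK ?num_real//; move: (`|y 0 i| * `|y 0 j|) => w.
  by rewrite ler_pdivlMr//; lra.
have inner i : \sum_j e * ((y 0 i ^+ 2 + y 0 j ^+ 2) / 2) =
    e / 2 * n%:R * y 0 i ^+ 2 + e / 2 * sqn y.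
  rewrite -mulr_sumr -mulr_suml big_split/= sumr_const card_ord -/(sqn y).
  rewrite -[y 0 i ^+ 2 *+ n]mulr_natr.
  by move: (y 0 i ^+ 2) (sqn y) (n%:R : R) => p q r; field.
rewrite (eq_bigr _ (fun i _ => inner i)) big_split/= -mulr_sumr -/(sqn y).
rewrite sumr_const card_ord -[(_ * sqn y) *+ n]mulr_natr.
move: (sqn y) (n%:R : R) => p q; rewrite le_eqVlt; apply/orP; left; apply/eqP.
by field.
Qed.

End rayleigh.

(** * Simplices, meshes and convexity *)

Section simplex.
Context (R : realType) (n : nat).
Implicit Types (K : {fset 'rV[R]_n}) (x y : 'rV[R]_n).

(* Row [k] is the [k]-th vertex preceded by the entry 1. *)
Definition vertex_mx K : 'M[R]_n.+1 :=
  \matrix_(k, j) rV_cons (1, nth 0 (enum_fset K) k) 0 j.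

(** Barycentric coordinates, as the solution of a linear system; the leading 1 makes them sum to 1.
    They are defined on the whole space and affine in [y]. *)
Definition bary K y : 'rV[R]_n.+1 := rV_cons (1, y) *m invmx (vertex_mx K).

Lemma mul_vertex_mx K (tau : 'rV[R]_n.+1) :
  tau *m vertex_mx K =
  \sum_k tau 0 k *: rV_cons (1, nth 0 (enum_fset K) k).
Proof.
rewrite mulmx_sum_row; apply: eq_bigr => k _; congr (_ *: _).
by apply/rowP => j; rewrite !mxE.
Qed.

Lemma sum_rV_cons (tau : 'rV[R]_n.+1) (F : 'I_n.+1 -> 'rV[R]_n) :
  \sum_k tau 0 k *: rV_cons (1, F k) = rV_cons (\sum_k tau 0 k, \sum_k tau 0 k *: F k).
Proof.
apply/rowP => j; rewrite summxE; have [i ->|->] := unliftP ord0 j.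
  rewrite rV_consS summxE; apply: eq_bigr => k _.
  by rewrite mxE rV_consS mxE.
by rewrite rV_cons0; apply: eq_bigr => k _; rewrite mxE rV_cons0 mulr1.
Qed.

Lemma simplex_sum K (V : nmodType) (F : 'rV[R]_n -> V) : is_simplex K ->
  \sum_(x <- K) F x = \sum_(k < n.+1) F (nth 0 (enum_fset K) k).
Proof.
move=> [sK _]; have -> : n.+1 = size (enum_fset K) by [].
by rewrite (big_nth 0) big_mkord.
Qed.

Lemma rV_cons_inj (a b : R) x y : rV_cons (a, x) = rV_cons (b, y) -> a = b /\ x = y.
Proof.
by move=> /(congr1 (@rV_uncons R n)); rewrite !rV_consK => -[-> ->].
Qed.

(** A vanishing combination of the rows is an affine dependence of the vertices: its first entry is
    the sum of the coefficients, the others form the combination of the points. *)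
Lemma vertex_mx_unit K : is_simplex K -> vertex_mx K \in unitmx.
Proof.
move=> sK; rewrite -row_free_unit; apply: inj_row_free => tau.
rewrite mul_vertex_mx sum_rV_cons.
have [sK1 indep] := sK.
have z0 : (0 : 'rV[R]_n.+1) = rV_cons (0, 0 : 'rV[R]_n).
  apply/rowP => j; have [i ->|->] := unliftP ord0 j.
    by rewrite rV_consS !mxE.
  by rewrite rV_cons0 mxE.
rewrite [X in _ = X -> _]z0 => /rV_cons_inj[s0 v0].
(* Independence is stated for coefficients that are functions of the point, so each vertex looks up
   its coefficient by its rank in the enumeration. *)
pose t x := tau 0 (inord (index x (enum_fset K))).
have tE (k : 'I_n.+1) : t (nth 0 (enum_fset K) k) = tau 0 k.
  by rewrite /t index_uniq ?fset_uniq ?inord_val// sK1.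
have t0 : forall x, x \in K -> t x = 0.
  apply: indep; rewrite (simplex_sum _ sK).
    by under eq_bigr do rewrite tE.
  by under eq_bigr do rewrite tE.
apply/rowP => k; rewrite [RHS]mxE.
by rewrite -tE; apply: t0; apply: mem_nth; rewrite sK1.
Qed.

(** The linear system for the coefficients has a unique solution, so convex coefficients must be the
    barycentric ones. A simplex thus becomes an intersection of [n.+1] half-spaces, which gives its
    convexity, closedness and interior points. *)
Lemma hullE K y : is_simplex K -> hull K y <-> forall k, 0 <= bary K y 0 k.
Proof.
move=> sK; have uK := vertex_mx_unit sK; have [sK1 _] := sK; split.
- move=> [t [t0 t1 ->]] k.
  pose tau : 'rV[R]_n.+1 := \row_k t (nth 0 (enum_fset K) k).
  suff -> : bary K (\sum_(x <- K) t x *: x) = tau.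
    by rewrite mxE; apply: t0; apply: mem_nth; rewrite sK1.
  rewrite /bary -(mulmxK uK tau) mul_vertex_mx sum_rV_cons; congr (rV_cons (_, _) *m _).
    by rewrite -t1 (simplex_sum _ sK); apply: eq_bigr => i _; rewrite mxE.
  by rewrite (simplex_sum _ sK); apply: eq_bigr => i _; rewrite mxE.
- move=> b0; pose tau := bary K y.
  pose t x := tau 0 (inord (index x (enum_fset K))).
  have tE (k : 'I_n.+1) : t (nth 0 (enum_fset K) k) = tau 0 k.
    by rewrite /t index_uniq ?fset_uniq ?inord_val// sK1.
  have := mulmxKV uK (rV_cons (1, y)); rewrite -/tau mul_vertex_mx sum_rV_cons.
  move=> /rV_cons_inj[s1 sy]; exists t; split => [x xK||].
  + exact: b0.
  + by rewrite (simplex_sum _ sK) -s1; apply: eq_bigr => k _; rewrite tE.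
  + by rewrite (simplex_sum _ sK) -[LHS]sy; apply: eq_bigr => k _; rewrite tE.
Qed.

Lemma polynomial_bary K k : polynomial (fun y => bary K y 0 k).
Proof.
under eq_fun do rewrite mxE.
apply: polynomial_sum => j _; apply: polynomial_mul; last exact: polynomial_cst.
have [i ->|->] := unliftP ord0 j.
  by under eq_fun do rewrite rV_consS; exact: polynomial_coord.
by under eq_fun do rewrite rV_cons0; exact: polynomial_cst.
Qed.

Lemma bary_conv K x y (s : R) :
  bary K (s *: x + (1 - s) *: y) = s *: bary K x + (1 - s) *: bary K y.
Proof.
rewrite /bary 2!scalemxAl -mulmxDl; congr (_ *m _); apply/rowP => j; rewrite [RHS]mxE.
have sc (a : R) (w : 'rV[R]_n.+1) : (a *: w) 0 j = a * w 0 j by rewrite mxE.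
rewrite !sc; have [i ->|->] := unliftP ord0 j; first by rewrite !rV_consS !mxE.
by rewrite !rV_cons0; ring.
Qed.

Lemma hull_conv K x y (s : R) : is_simplex K -> 0 <= s <= 1 ->
  hull K x -> hull K y -> hull K (s *: x + (1 - s) *: y).
Proof.
move=> sK /andP[s0 s1] /(hullE _ sK) hx /(hullE _ sK) hy; apply/(hullE _ sK) => k.
by rewrite bary_conv mxE [X in X + _]mxE [X in _ + X]mxE addr_ge0// mulr_ge0// subr_ge0.
Qed.

Lemma hull_closed K : is_simplex K -> closed (hull K).
Proof.
move=> sK.
have -> : hull K = \bigcap_(k in [set: 'I_n.+1]) [set y | 0 <= bary K y 0 k].
  apply/seteqP; split => y.
    by move=> /(hullE _ sK) h k _; exact: h.
  by move=> h; apply/(hullE _ sK) => k; exact: h.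
apply: closed_bigI => k _.
rewrite (_ : [set y | _] = (fun y => bary K y 0 k) @^-1` [set r | 0 <= r])//.
apply: closed_comp => [x _|]; last exact: closed_ge.
exact/polynomial_continuous/polynomial_bary.
Qed.

Lemma hull_interior K y : is_simplex K -> (forall k, 0 < bary K y 0 k) ->
  (hull K)^° y.
Proof.
move=> sK b0.
have h k : nbhs y [set z : 'rV[R]_n | 0 < bary K z 0 k].
  have cb := polynomial_continuous (polynomial_bary K k) (x := y).
  by apply: (cb [set r | 0 < r]); apply: open_nbhs_nbhs; split; [exact: open_gt|exact: b0].
apply: filterS (filter_forall (nbhs_filter y) h) => z hz.
by apply/(hullE _ sK) => k; exact/ltW/hz.
Qed.

(** Any point can be moved slightly towards the barycentre [b], all of whose coordinates are
    [n.+1%:R^-1]; the coordinates of the moved point are then positive. *)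
Lemma hull_interior_dense K : is_simplex K -> hull K `<=` closure (hull K)^°.
Proof.
move=> sK y hy N Ny.
pose tau : 'rV[R]_n.+1 := const_mx n.+1%:R^-1.
pose b : 'rV[R]_n := \sum_k tau 0 k *: nth 0 (enum_fset K) (k : 'I_n.+1).
have bb : bary K b = tau.
  rewrite /bary -(mulmxK (vertex_mx_unit sK) tau) mul_vertex_mx sum_rV_cons.
  congr (rV_cons (_, _) *m _); under eq_bigr do rewrite mxE.
  by rewrite sumr_const card_ord -[RHS]mulr_natr mulVf// pnatr_eq0.
pose z (s : R) := s *: b + (1 - s) *: y.
have cz : z s @[s --> 0] --> y.
  have -> : y = 0 *: b + (1 - 0) *: y by rewrite scale0r add0r subr0 scale1r.
  apply: cvgD; first by apply: cvgZr_tmp; exact: cvg_id.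
  by apply: cvgZr_tmp; apply: cvgB; [exact: cvg_cst|exact: cvg_id].
have [/= d d0 dN] : nbhs (0 : R) (z @^-1` N) by exact: cz.
pose s := Num.min (d / 2) 1.
have s0 : 0 < s by rewrite lt_min ltr01 divr_gt0.
have sd : s < d.
  by rewrite gt_min ltr_pdivrMr// mulrDr mulr1 ltrDl d0.
exists (z s); split; last by apply: dN; rewrite /= sub0r normrN gtr0_norm.
apply: hull_interior => // k; rewrite bary_conv bb mxE [X in X + _]mxE [X in _ + X]mxE.
move: hy => /(hullE _ sK) hy.
rewrite mxE ltr_pwDl// ?mulr_gt0 ?invr_gt0 ?ltr0n// mulr_ge0//.
by rewrite subr_ge0 ge_min lexx orbT.
Qed.

End simplex.

(** * Density of element interiors, and convexity of C^1 piecewise polynomials *)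

Section mesh.
Context (R : realType) (n : nat).
Variables (Omega : set 'rV[R]_n) (Th : {fset {fset 'rV[R]_n}}).
Hypotheses (oO : open Omega) (tri : triangulation Omega Th).

(** The mesh covers [closure Omega], so an element may touch the boundary of [Omega]. But an open
    set that contains a point of [closure Omega] meets [Omega], and this applies to small open
    pieces of the interior of the element. *)
Lemma element_dense K : K \in Th -> hull K `<=` closure ((hull K)^° `&` Omega).
Proof.
move=> KT x Kx N; rewrite nbhsE => -[N' [oN' N'x] N'N].
have [sK cov _] := tri.
have [|y [Ky N'y]] := hull_interior_dense (sK _ KT) Kx (B := N').
  exact: open_nbhs_nbhs.
have : closure Omega y.
  by rewrite cov; exists K => //; exact: interior_subset.
have : nbhs y ((hull K)^° `&` N').
  by apply: open_nbhs_nbhs; split => //; apply: openI => //; exact: open_interior.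
move=> Ny /(_ _ Ny)[z [Oz [Kz N'z]]].
by exists z; split => //; exact: N'N.
Qed.

Lemma element_closed_prop K (P : set 'rV[R]_n) : K \in Th -> closed P ->
  (hull K)^° `&` Omega `<=` P -> hull K `<=` P.
Proof.
move=> KT cP VP; apply: subset_trans (element_dense KT) _.
by rewrite closureE; exact: smallest_sub.
Qed.

Lemma open_element K : open ((hull K)^° `&` Omega).
Proof. by apply: openI => //; exact: open_interior. Qed.

(** Inside the element the functions agree locally. On its faces the equality survives by density
    and continuity of both derivatives: this is where [v] being C^1 makes the gradients of
    neighbouring pieces match. *)
Lemma partial_on_element K (v p : 'rV[R]_n -> R) i x : K \in Th ->
  Ck 1 Omega v -> polynomial p ->
  (forall y, Omega y -> hull K y -> v y = p y) -> Omega x -> hull K x ->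
  partial i v x = partial i p x.
Proof.
move=> KT Cv pp vp Ox Kx; apply/eqP; rewrite -subr_eq0; apply/negPn/negP => d0.
pose dlt y := partial i v y - partial i p y.
have cd : {for x, continuous dlt}.
  apply: continuousB; last exact/polynomial_continuous/polynomial_partial.
  by have [_ /(_ i)[_ [+ _]]] := Cv; exact.
have : nbhs x (dlt @^-1` [set r | r != 0]).
  by apply: cd; apply: open_nbhs_nbhs; split => //; exact: open_neq.
move=> /(element_dense KT Kx)[y [Vy /eqP]]; apply.
rewrite /dlt; apply/eqP; rewrite subr_eq0; apply/eqP; apply: near_eq_partial.
have := open_nbhs_nbhs (conj (@open_element K) Vy); apply: filterS => z [Kz Oz].
by apply: vp => //; exact: interior_subset.
Qed.

(* Some element containing [z s0] also contains [z s], for [s] near [s0]. *)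
Lemma near_common_element (z : R -> 'rV[R]_n) (s0 : R) : {for s0, continuous z} ->
  \forall s \near s0, Omega (z s) ->
    exists K, [/\ K \in Th, hull K (z s0) & hull K (z s)].
Proof.
move=> cz; have [sK cov _] := tri.
(* The elements that miss [z s0] are finitely many closed sets, so their union stays away from [z s]
   for [s] near [s0]. *)
pose F := \bigcup_(K in [set K | K \in Th /\ ~ hull K (z s0)]) hull K.
have cF : closed F.
  apply: closed_bigcup.
    by apply: (sub_finite_set _ (finite_fset Th)) => K [].
  by move=> K [KT _]; exact: hull_closed (sK _ KT).
have nF : nbhs s0 (z @^-1` (~` F)).
  apply: cz; apply: open_nbhs_nbhs; split; first exact: closed_openC.
  by move=> [K [KT]].
apply: filterS nF => s nFs Os.
have : closure Omega (z s) by exact: subset_closure.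
rewrite cov => -[K KT Ks]; exists K; split => //.
by apply: contrapT => nK; apply: nFs; exists K.
Qed.

Lemma piecewise_convex (v : 'rV[R]_n -> R) :
  convex_set (Omega : set (convex_lmodType 'rV[R]_n)) -> Ck 1 Omega v ->
  (forall K, K \in Th -> exists p, [/\ polynomial p,
     forall y, Omega y -> hull K y -> v y = p y &
     forall y, hull K y -> posdef (hessian p y)]) ->
  convex_function (Omega : set (convex_lmodType 'rV[R]_n)) v.
Proof.
move=> cvx Cv vp t x y /set_mem Ox /set_mem Oy.
pose e : 'rV[R]_n := (x : 'rV[R]_n) - y.
have [e0|e0] := eqVneq e 0.
  have -> : x = y by apply/eqP; rewrite -subr_eq0; exact/eqP.
  by rewrite !convmm.
pose z (s : R) := s *: e + (y : 'rV[R]_n).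
have zE s : z s = s *: (x : 'rV[R]_n) + (1 - s) *: (y : 'rV[R]_n).
  by rewrite /z scalerBr scalerBl scale1r -addrA [- _ + _]addrC.
have cz : continuous z.
  by move=> s; apply: cvgD; [apply: cvgZr_tmp; exact: cvg_id|exact: cvg_cst].
have Oz s : 0 <= s <= 1 -> Omega (z s).
  move=> /andP[s0 s1]; rewrite zE.
  have := cvx x y (Itv01 s0 s1); rewrite !inE => /(_ Ox Oy).
  by [].
pose h s := v (z s) - (s * v x + (1 - s) * v y).
have cL (a b : R) : continuous (fun s : R => s * a + (1 - s) * b).
  move=> s; apply: cvgD; (apply: cvgM; last exact: cvg_cst); first exact: cvg_id.
  by apply: cvgB; [exact: cvg_cst|exact: cvg_id].
have ch s : 0 <= s <= 1 -> {for s, continuous h}.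
  move=> s01; apply: (@cvgB _ _ _ _ _ (v \o z) (fun s => s * v x + (1 - s) * v y)).
    apply: continuous_comp; first exact: cz.
    exact: (Ck_continuous Cv (Oz _ s01)).
  exact: cL.
have [s s01 smax] : exists2 s, s \in `[0, 1]%R & forall r, r \in `[0, 1]%R -> h r <= h s.
  apply: EVT_max => //; apply: continuous_in_subspaceT => s.
  by rewrite inE/= in_itv/= => /ch.
rewrite in_itv/= in s01.
suff hs : h s <= 0.
  have t01 : 0 <= t%:num <= 1 by rewrite ge0 le1.
  have := smax t%:num; rewrite in_itv/= t01 => /(_ isT)/le_trans/(_ hs).
  by rewrite subr_le0 zE.
rewrite leNgt; apply/negP => hs.
have [s0|s0] := eqVneq s 0.
  by move: hs; rewrite s0 /h /z scale0r add0r mul0r add0r subr0 mul1r subrr ltxx.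
have [s1|s1] := eqVneq s 1.
  by move: hs; rewrite s1 /h zE scale1r mul1r subrr scale0r mul0r !addr0 subrr ltxx.
have {s0 s1} s01' : 0 < s < 1.
  by move: s01; rewrite !lt_neqAle eq_sym s0 s1.
(* The slope at [s] of [v] along the segment minus that of the chord. It is computed from [v] itself
   and so is the same for every element containing [z s]. *)
pose c := \sum_i e 0 i * partial i v (z s) - (v x - v y).
(* Strict position above the tangent gives [h r > h s + c * (r - s)], while maximality gives
   [h r <= h s]. *)
have above r K : 0 <= r <= 1 -> r != s -> K \in Th -> hull K (z s) -> hull K (z r) ->
    c * (r - s) < 0.
  move=> r01 rs KT Ks Kr; have [p [pp vpK pd]] := vp _ KT.
  have sK : is_simplex K by have [+ _ _] := tri; exact.
  have d0 : (r - s) *: e != 0 by rewrite scaler_eq0 subr_eq0 negb_or rs.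
  have line q : q *: ((r - s) *: e) + z s = q *: z r + (1 - q) *: z s.
    by rewrite /z; apply/rowP => k; rewrite !mxE; ring.
  have pdseg q : 0 <= q <= 1 -> posdef (hessian p (q *: ((r - s) *: e) + z s)).
    by move=> q01; rewrite line; exact/pd/hull_conv.
  have := posdef_above_tangent pp d0 pdseg.
  have -> : (r - s) *: e + z s = z r by rewrite /z addrA -scalerDl subrK.
  rewrite -(vpK _ (Oz _ s01) Ks) -(vpK _ (Oz _ r01) Kr).
  have -> : \sum_i ((r - s) *: e) 0 i * partial i p (z s) =
            (r - s) * \sum_i e 0 i * partial i v (z s).
    rewrite mulr_sumr; apply: eq_bigr => i _; rewrite mxE -mulrA.
    by rewrite (partial_on_element i KT Cv pp vpK (Oz _ s01) Ks).
  have := smax r; rewrite in_itv/= => /(_ r01); rewrite /h /c.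
  move: (\sum_i _) (v (z r)) (v (z s)) (v x) (v y) => S A B X Y; clear; nra.
have [d /= d0 dP] := near_common_element (cz s).
(* This step keeps [s - r] and [s + r] in [0, 1] and within [d] of [s]; the two points give [c * r]
   opposite strict signs. *)
pose r := Num.min (d / 2) (Num.min s (1 - s)).
have /andP[s0 s1] := s01'.
have r0 : 0 < r by rewrite !lt_min divr_gt0// s0 subr_gt0 s1.
have rd : r < d by rewrite gt_min ltr_pdivrMr// mulrDr mulr1 ltrDl d0.
have rs : r <= s by rewrite !ge_min lexx !orbT.
have rs1 : r <= 1 - s by rewrite !ge_min lexx !orbT.
have neg q : 0 <= q <= 1 -> q != s -> `|s - q| < d -> c * (q - s) < 0.
  move=> q01 qs qd; have [K [KT Ks Kq]] := dP q qd (Oz q q01).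
  exact: above q01 qs KT Ks Kq.
have h1 : c * (s - r - s) < 0.
  apply: neg; [lra|by rewrite lt_eqF// gtrBl|].
  by rewrite subKr gtr0_norm.
have h2 : c * (s + r - s) < 0.
  apply: neg; [lra|by rewrite gt_eqF// ltrDl|].
  by rewrite opprD addrA subrr sub0r normrN gtr0_norm.
move: h1 h2; rewrite addrAC subrr sub0r mulrN [s + r - s]addrAC subrr add0r.
by rewrite oppr_lt0 => c0 /(lt_trans c0); rewrite ltxx.
Qed.

End mesh.

(** * Perturbation of the Hessian on one element *)

Section fe.
Context (R : realType) (n : nat).
Implicit Types (Omega : set 'rV[R]_n) (Th : {fset {fset 'rV[R]_n}}).

Lemma poly_funB d (p q : 'rV[R]_n -> R) : poly_fun d p -> poly_fun d q ->
  poly_fun d (fun x => p x - q x).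
Proof.
move=> [c pE] [e qE]; exists (fun a => c a - e a) => x.
by rewrite pE qE -sumrB; apply: eq_bigr => a _; rewrite mulrBl.
Qed.

Lemma fe_spaceB Omega Th d (v w : 'rV[R]_n -> R) : open Omega ->
  fe_space Omega Th d v -> fe_space Omega Th d w ->
  fe_space Omega Th d (v \- w).
Proof.
move=> oO [Cv vp] [Cw wp]; split; first exact: Ck_sub.
move=> K KT; have [p pp vpE] := vp K KT; have [q qp wqE] := wp K KT.
exists (fun x => p x - q x); first exact: poly_funB.
by move=> x Ox Kx; rewrite /= vpE ?wqE.
Qed.

(** This puts [u] in the domain of the quasi-interpolation operator, so that [Q h u] is a finite
    element function: [u] is bounded on the compact closure, which has finite measure. *)
Lemma bounded_continuous_L1 Omega (u : 'rV[R]_n -> R) : open Omega ->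
  bounded_set Omega -> {within closure Omega, continuous u} ->
  (forall x, Omega x -> {for x, continuous u}) -> L1 Omega u.
Proof.
move=> oO bO cu cuO; have mO := open_measurable_rV oO.
have cO : compact (closure Omega).
  apply: bounded_closed_compact; last exact: closed_closure.
  have [M [Mr hM]] := bO; exists M; split => // M' MM'.
  suff : closure Omega `<=` Num.norm @^-1` [set r | r <= M'] by [].
  rewrite closureE; apply: smallest_sub; last exact: hM.
  by apply: closed_comp; [move=> x _; exact: norm_continuous|exact: closed_le].
apply: measurable_bounded_integrable => //.
- apply: (@le_lt_trans _ _ (lebesgue_rV R n (closure Omega))).
    apply: le_measure; rewrite ?inE//; last exact: subset_closure.
    exact: closed_measurable_rV (@closed_closure _ _).
  apply: compact_measure_lty => //.
  exact: closed_measurable_rV (@closed_closure _ _).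
- exact: continuous_on_measurable.
- have [N [Nr hN]] := compact_image_bounded cO cu; exists N; split => // y Ny x xO.
  by apply: hN Ny _ _; exact: subset_closure.
Qed.

Lemma open_element_interiors Th : open (element_interiors Th).
Proof.
rewrite openE => x [K KT Kx].
have : nbhs x (hull K)^° by apply: open_nbhs_nbhs; split => //; exact: open_interior.
by apply: filterS => y Ky; exists K.
Qed.

Lemma near_bounds (a b c lo hi : R) :
  - a <= c - b -> c - b <= a -> lo <= b -> b <= hi -> lo - a <= c <= hi + a.
Proof. by move=> ? ? ? ?; apply/andP; split; lra. Qed.

(** Here [w] stands for [Q h u]. Each of the two norms controls second derivatives by [e] on the
    open part [V] of the element, so entries differ by at most [e + e] and quadratic forms by [n]
    times that. *)
Lemma hessian_perturbation Omega Th K d (u v w p : 'rV[R]_n -> R) (m M e : R) :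
  (0 < n)%N -> open Omega -> K \in Th -> triangulation Omega Th ->
  Ck 2 Omega u ->
  (forall x, Omega x -> m <= lambda_min (hessian u x) /\ lambda_max (hessian u x) <= M) ->
  fe_space Omega Th d w ->
  (sobolev_norm 2 +oo (element_interiors Th) (u \- w)%R <= e%:E)%E ->
  (sobolev_seminorm 2 +oo Omega (v \- w)%R <= e%:E)%E ->
  polynomial p -> (forall x, Omega x -> hull K x -> v x = p x) ->
  forall x, hull K x -> forall y,
    (m - (e + e) * n%:R) * sqn y <= qform (hessian p x) y y
      <= (M + (e + e) * n%:R) * sqn y.
Proof.
move=> n0 oO KT tri Cu ueig [_ wp] uw vw pp vp.
have [q /poly_fun_polynomial qp wq] := wp K KT.
pose V := (hull K)^° `&` Omega.
have oV : open V by apply: openI => //; exact: open_interior.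
have VO : V `<=` Omega by move=> x [].
have VK x : V x -> hull K x by move=> [/interior_subset].
have VU : V `<=` element_interiors Th by move=> x [Kx _]; exists K.
have CuV : Ck 2 V u by exact: Ck_subset VO Cu.
have Cq := polynomial_Ck 2 V qp; have Cp := polynomial_Ck 2 V pp.
have close x i j : V x -> `|(hessian p x - hessian u x) i j| <= e + e.
  move=> Vx.
  have [g1 wg1 g1e] := sobolev_norm2_deriv i j uw.
  have [g2 wg2 g2e] := sobolev_seminorm2_deriv i j vw.
  have uwq y : V y -> (u \- w) y = u y - q y.
    by move=> Vy; rewrite /= wq//; [exact: VO|exact: VK].
  have vwq y : V y -> (v \- w) y = p y - q y.
    by move=> Vy; rewrite /= wq ?vp//; by [exact: VO|exact: VK].
  have h1 := weak_deriv2_bound (open_element_interiors (Th := Th)) oV VU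
    (Ck_sub oV CuV Cq) uwq wg1 g1e Vx.
  have h2 := weak_deriv2_bound oO oV VO (Ck_sub oV Cp Cq) vwq wg2 g2e Vx.
  rewrite (partialB2 i j oV CuV Cq Vx) in h1.
  rewrite (partialB2 i j oV Cp Cq Vx) in h2.
  rewrite 2!mxE [X in _ + X]mxE [X in _ - X]mxE; move: h1 h2.
  set a := partial i (partial j u) x; set b := partial i (partial j p) x.
  set c := partial i (partial j q) x; move: a b c => a b c h1 h2.
  rewrite -(subrKA c) -[c - a]opprB; apply: le_trans (ler_normB _ _) _.
  exact: lerD.
(* The condition no longer mentions [u]: it makes sense on all of [hull K] and is closed, so it
   extends from the dense set [V]. *)
pose P := [set x | forall y, (m - (e + e) * n%:R) * sqn y
  <= qform (hessian p x) y y <= (M + (e + e) * n%:R) * sqn y].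
suff : hull K `<=` P by [].
apply: (element_closed_prop tri KT) => [|x Vx y].
  have -> : P = \bigcap_(y in [set: 'rV[R]_n])
        (fun x => qform (hessian p x) y y) @^-1`
        [set` `[(m - (e + e) * n%:R) * sqn y, (M + (e + e) * n%:R) * sqn y]].
    apply/seteqP; split => x h y.
      by move=> _; rewrite /= in_itv/=; exact: h.
    by have := h y I; rewrite /= in_itv.
  apply: closed_bigI => y _; apply: closed_comp => [x _|]; last exact: itv_closed.
  apply: polynomial_continuous; under eq_fun do rewrite qformE.
  apply: polynomial_sum => i _; apply: polynomial_sum => j _.
  apply: polynomial_mul; last exact: polynomial_cst.
  apply: polynomial_mul; first exact: polynomial_cst.
  by under eq_fun do rewrite mxE; do 2 apply: polynomial_partial.
have Ox : Omega x by exact: VO.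
have [mA AM] := ueig x Ox.
have /andP[l1 l2] := lambda_qform y n0 (hessian_sym oO Cu Ox).
have := qform_entry_bound y (fun i j => close x i j Vx).
rewrite qform_sub ler_norml => /andP[d1 d2].
have sq0 : 0 <= sqn y by apply: sumr_ge0 => i _; exact: sqr_ge0.
have m1 : m * sqn y <= qform (hessian u x) y y by apply: le_trans l1; exact: ler_wpM2r.
have m2 : qform (hessian u x) y y <= M * sqn y by apply: le_trans l2 _; exact: ler_wpM2r.
rewrite [(m - _) * _]mulrBl [(M + _) * _]mulrDl.
exact: near_bounds d1 d2 m1 m2.
Qed.

End fe.

Theorem lemma2p5 (R : realType) (n : nat) (n23 : n = 2%N \/ n = 3%N)
  (Omega : set 'rV[R]_n) (Omega_dom : polyhedral_convex_domain Omega)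
  (H : set R) (T : R -> {fset {fset 'rV[R]_n}})
  (T_fam : triangulation_family Omega H T) (d : nat)
  (Q : R -> ('rV[R]_n -> R) -> ('rV[R]_n -> R))
  (Q_interp : quasi_interpolation Omega H T d Q)
  (Q_approx : approximation_property Omega H T d Q)
  (V_inv : inverse_estimates Omega H T d)
  (C0 : R) (C0_gt0 : 0 < C0)
  (C0_inv : forall h v, H h -> fe_space Omega (T h) d v ->
     (sobolev_seminorm 2 +oo%E Omega v <=
        (C0 * h `^ (- 1 - n%:R / 2))%:E * sobolev_norm 1 2%:E Omega v)%E)
  (f g u : 'rV[R]_n -> R) (c0 : R) (c0_gt0 : 0 < c0)
  (f_ge : forall x, Omega x -> c0 <= f x)
  (l : nat) (l_ge3 : (3 <= l)%N) (l_le : (l <= d)%N)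
  (u_sobolev : in_sobolev l.+1 +oo%E Omega u)
  (u_C2 : Ck 2 Omega u) (u_cont : {within closure Omega, continuous u})
  (u_convex : strictly_convex_on Omega u)
  (u_eq : forall x, Omega x -> \det (hessian u x) = f x)
  (u_bnd : forall x, (closure Omega `\` Omega) x -> u x = g x)
  (m' M' : R) (m'_gt0 : 0 < m') (M'_gt0 : 0 < M')
  (u_eig : forall x, Omega x ->
     m' <= lambda_min (hessian u x) /\
     lambda_min (hessian u x) <= lambda_max (hessian u x) /\
     lambda_max (hessian u x) <= M')
  (delta : R) (delta_gt0 : 0 < delta)
  (delta_lt : delta < Num.min 1 (m' / (2 * n%:R * C0))) :
  exists2 h0 : R, 0 < h0 &
  forall h, H h -> h < h0 ->
  forall v, fe_space Omega (T h) d v ->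
  (sobolev_norm 1 2%:E Omega (v \- Q h u)%R
     < (delta * h `^ (1 + n%:R / 2) / 2)%:E)%E ->
  (* p is the polynomial v|_K *)
  (forall K, K \in T h ->
   forall p, poly_fun d p -> (forall x, Omega x -> hull K x -> v x = p x) ->
   forall x, hull K x ->
     posdef (hessian p x) /\
     m' / 2 <= lambda_min (hessian p x) /\
     lambda_min (hessian p x) <= lambda_max (hessian p x) /\
     lambda_max (hessian p x) <= 3 * M' / 2) /\
  convex_function (Omega : set (convex_lmodType 'rV[R]_n)) v.
Proof.
have n0 : (0 < n)%N by case: n23 => ->.
have nR : 0 < n%:R :> R by rewrite ltr0n.
have [[x0 Ox0] oO bO cvxO _] := Omega_dom.
(* Evaluated at one point of the nonempty [Omega]; it turns [M' + m' / 2] into the bound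
   [3 * M' / 2]. *)
have mM : m' <= M'.
  by have [h1 [h2 h3]] := u_eig _ Ox0; exact: le_trans h1 (le_trans h2 h3).
have [N N0 NE] := sobolev_seminorm_y_finite oO u_sobolev.
have [|C Capprox] := Q_approx +oo%E 2 l (leey _).
  by rewrite l_le andbT (leq_trans _ l_ge3).
pose e := m' / (4 * n%:R).
have e0 : 0 < e by rewrite divr_gt0// mulr_gt0.
have CN0 : 0 < `|C| * N + 1 by rewrite ltr_wpDl// mulr_ge0.
(* The constant [C] may be negative and [N] may be 0, hence the absolute value and the added 1. *)
exists (Num.min 1 (e / (`|C| * N + 1))); first by rewrite lt_min ltr01 divr_gt0.
move=> h Hh; rewrite lt_min => /andP[h1 he] v fv vQ.
have [hT _ _ _] := T_fam; have [h0 tri] := hT h Hh.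
have uL1 : L1 Omega u.
  by apply: bounded_continuous_L1 => // x; exact: (Ck_continuous u_C2).
have [fQ _ _] := Q_interp h Hh; have {}fQ := fQ u uL1.
have approx : (sobolev_norm 2 +oo (element_interiors (T h)) (u \- Q h u)%R <= e%:E)%E.
  apply: le_trans (Capprox h u Hh u_sobolev) _; rewrite NE -EFinM lee_fin.
  (* The exponent of [h] is [l - 1], at least 2; as [h < 1], the power is at most [h], and this is
     all that the choice of the threshold needs. *)
  have [k lk] : exists k, l = k.+3 by exists (l - 3)%N; rewrite -addn3 subnK.
  have hl : h ^+ (l + 1 - 2) <= h.
    by rewrite lk addn1 !subSS subn0 exprS ger_pMr// exprn_ile1// ltW.
  have hl0 : 0 <= h ^+ (l + 1 - 2) by rewrite exprn_ge0// ltW.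
  have Ch : C * h ^+ (l + 1 - 2) <= `|C| * h.
    apply: (@le_trans _ _ (`|C| * h ^+ (l + 1 - 2))).
      by rewrite ler_wpM2r// ler_norm.
    by rewrite ler_wpM2l.
  apply: le_trans (ler_wpM2r N0 Ch) _; rewrite mulrAC.
  move: he; rewrite ltr_pdivlMr// mulrDr mulr1 mulrC => /ltW; apply: le_trans.
  by rewrite lerDl ltW.
have inv : (sobolev_seminorm 2 +oo Omega (v \- Q h u)%R <= e%:E)%E.
  apply: le_trans (C0_inv h _ Hh (fe_spaceB oO fv fQ)) _.
  apply: (@le_trans _ _ ((C0 * h `^ (- 1 - n%:R / 2))%:E *
                         (delta * h `^ (1 + n%:R / 2) / 2)%:E)%E).
    by apply: lee_wpmul2l; [rewrite lee_fin mulr_ge0 ?powR_ge0 ?ltW|exact: ltW].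
  rewrite -EFinM lee_fin.
  (* The radius of the ball around [Q h u] is scaled to cancel the inverse estimate exactly; what
     remains is [C0 * delta / 2], at most [e] by the choice of [delta]. *)
  have hh : h `^ (- 1 - n%:R / 2) * h `^ (1 + n%:R / 2) = 1.
    rewrite -powRD; last by rewrite (gt_eqF h0) implybT.
    by rewrite (_ : _ + _ = 0) ?powRr0//; ring.
  have -> : C0 * h `^ (- 1 - n%:R / 2) * (delta * h `^ (1 + n%:R / 2) / 2) =
      C0 * delta / 2 * (h `^ (- 1 - n%:R / 2) * h `^ (1 + n%:R / 2)) by ring.
  rewrite hh mulr1 ler_pdivrMr//.
  move: delta_lt; rewrite lt_min => /andP[_ /ltW dl].
  rewrite mulrC -ler_pdivlMr//; apply: le_trans dl _.
  by rewrite le_eqVlt /e; apply/orP; left; apply/eqP; field; rewrite !gt_eqF.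
have ueig x : Omega x -> m' <= lambda_min (hessian u x) /\ lambda_max (hessian u x) <= M'.
  by move=> /u_eig[? [_ ?]].
have main K p x : K \in T h -> polynomial p ->
    (forall x, Omega x -> hull K x -> v x = p x) -> hull K x ->
    forall y, m' / 2 * sqn y <= qform (hessian p x) y y <= 3 * M' / 2 * sqn y.
  move=> KT pp vp Kx y.
  have := hessian_perturbation n0 oO KT tri u_C2 ueig fQ approx inv pp vp Kx y.
  have -> : (e + e) * n%:R = m' / 2 by rewrite /e; field; rewrite gt_eqF.
  have sq0 : 0 <= sqn y by apply: sumr_ge0 => i _; exact: sqr_ge0.
  move=> /andP[l1 l2]; apply/andP; split.
    by apply: le_trans l1; apply: ler_wpM2r => //; lra.
  by apply: le_trans l2 _; apply: ler_wpM2r => //; lra.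
have sym (p : 'rV[R]_n -> R) x : polynomial p -> (hessian p x)^T = hessian p x.
  by move=> pp; apply: (hessian_sym openT (polynomial_Ck 2 _ pp)).
have pd K p x : K \in T h -> polynomial p ->
    (forall x, Omega x -> hull K x -> v x = p x) -> hull K x -> posdef (hessian p x).
  move=> KT pp vp Kx; split; first exact: sym.
  move=> y y0; have /andP[+ _] := main K p x KT pp vp Kx y.
  by apply: lt_le_trans; rewrite mulr_gt0 ?divr_gt0// sqn_gt0.
split.
  move=> K KT p /poly_fun_polynomial pp vp x Kx.
  have [? ? ?] := lambda_bounds n0 (sym p x pp) (main K p x KT pp vp Kx).
  by split; [exact: (pd K p x KT pp vp Kx)|split].
have [Cv vp] := fv.
apply: (piecewise_convex oO tri) => // K KT.
have [p /poly_fun_polynomial pp vpE] := vp K KT.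
by exists p; split => // y Ky; exact: (pd K p y KT pp vpE Ky).
Qed.
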